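(* Let $b>0$ and let $\mathcal{F}$ be a countable class of measurable functions $f:\Omega\to\mathbb{R}$ with $-b\le f(x)\le b$ for all $f\in\mathcal{F}$ and $x\in\Omega$. Let $$Z=Z(x)=\sup_{f\in\mathcal{F}}\sum_{i=1}^n f(x_i),\qquad V=V(x)=\mathbb{E}_y\sup_{f\in\mathcal{F}}\sum_{i=1}^n\bigl(f(x_i)-f(y_i)\bigr)^2 .$$ Then for all $t\ge\log 2$, $$\mathbb{P}\biggl(|Z-\mathbb{E}Z|\ge 2\Bigl(t\Bigl(\mathbb{E}V+\frac{2b}{3}\bigl(18\,\mathbb{E}V\,t+4b^2t^2\bigr)^{1/2}+\frac{4b^2t}{3}\Bigr)\Bigr)^{1/2}\biggr)\le 4e^{1-(\sqrt{t}-\sqrt{\log 2})^2}+e^{-t}.$$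
   Context: $(\Omega,\mu)$ is a probability space and $n\ge1$. The points $x=(x_1,\dots,x_n)$ and $y=(y_1,\dots,y_n)$ are independent, each with law $\mu^n$ on $\Omega^n$; $\mathbb{P}$ and $\mathbb{E}$ refer to the law of $x$, and $\mathbb{E}_y$ is expectation over $y$ with $x$ fixed. *)

(* Defs.v *)
From HB Require Import structures.
From mathcomp Require Import all_boot all_order all_algebra.
From mathcomp Require Import all_classical all_reals all_analysis.

Set Implicit Arguments.
Unset Strict Implicit.
Unset Printing Implicit Defensive.

Import Order.TTheory GRing.Theory Num.Theory.
Import numFieldNormedType.Exports.

Local Open Scope classical_set_scope.
Local Open Scope ring_scope.

Section product_law.
Context d (T : measurableType d) (R : realType) (mu : probability T R).

Definition tuple_cons n (p : T * n.-tuple T) : n.+1.-tuple T :=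
  [tuple of p.1 :: p.2].

Lemma measurable_tuple_cons n :
  measurable_fun [set: T * n.-tuple T] (@tuple_cons n).
Proof. exact: measurable_cons. Qed.

HB.instance Definition _ n := isMeasurableFun.Build _ _ _ _ (@tuple_cons n)
  (@measurable_tuple_cons n).

(* The n-fold product measure on Omega^n, represented as n.-tuple T with the
   sigma-algebra generated by the coordinates; [power_probE] characterizes it. *)
Fixpoint power_prob n : probability (n.-tuple T) R :=
  match n with
  | 0 => \d_([tuple] : 0.-tuple T)
  | m.+1 => distribution (mu \x power_prob m)%E (@tuple_cons m)
  end.

Lemma power_probE n (A : 'I_n -> set T) : (forall i, measurable (A i)) ->
  power_prob n [set x | forall i, A i (tnth x i)] = (\prod_(i < n) mu (A i))%E.
Proof.
elim: n A => [|n IH] A mA.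
  by rewrite big_ord0 /= diracE mem_set// => -[].
rewrite big_ord_recl -IH//= /distribution/= /pushforward -product_measure1E//.
- congr (_ _); apply/seteqP; split => -[a x] /= H.
  + split; first exact: H ord0.
    by move=> i; have := H (lift ord0 i); rewrite tnthS.
  + move=> i; case: (unliftP ord0 i) => [j|] ->; last by case: H.
    by rewrite tnthS; case: H.
- rewrite (_ : mkset _ = \bigcap_(i in [set: 'I_n])
      ((fun x : n.-tuple T => tnth x i) @^-1` A (lift ord0 i))).
    apply: fin_bigcap_measurable => // i _.
    by rewrite -[X in measurable X]setTI; exact: measurable_tnth.
  by apply/seteqP; split => x /= H i; [move=> _|]; apply: H.
Qed.

End product_law.

Section functionals.
Context d (T : measurableType d) (R : realType) (n : nat).

(* [sup] is the supremum in R: the sets below are bounded as soon as the class F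
   is uniformly bounded. For the empty class it takes the value 0. *)
Definition Zsup (F : set (T -> R)) (x : n.-tuple T) : R :=
  sup [set \sum_(i < n) f (tnth x i) | f in F].

Definition Vsup (mu : probability T R) (F : set (T -> R)) (x : n.-tuple T) : R :=
  let W (y : n.-tuple T) : R :=
    sup [set \sum_(i < n) (f (tnth x i) - f (tnth y i)) ^+ 2 | f in F] in
  fine 'E_(power_prob mu n)[W]%E.

End functionals.

(* Main.v *)
From HB Require Import structures.
Require Import Defs.
From mathcomp Require Import all_boot all_order all_algebra.
From mathcomp Require Import all_classical all_reals all_analysis.
From mathcomp Require Import measurable_realfun.
From mathcomp Require Import ring lra.

Set Implicit Arguments.
Unset Strict Implicit.
Unset Printing Implicit Defensive.

Import Order.TTheory GRing.Theory Num.Theory.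
Import numFieldNormedType.Exports.

Local Open Scope classical_set_scope.
Local Open Scope ring_scope.

(** Write W(x,y) = sup_f sum_i (f(x_i) - f(y_i))^2, so that V(x) is the mean of
    W(x,y) over y. The proof compares Z(x) with an independent copy Z(y), uses W as
    the variance proxy of the comparison, and controls V separately.

    Given the unordered pairs {x_i, y_i}, the sample x is a uniformly random choice
    of one point in each pair, hence of a vertex e of the cube {0,1}^n, and y is the
    opposite choice. As a function g of e, Z is a supremum of affine functions whose
    squared slopes add up to at most W. A transport inequality for the cube, in the
    spirit of Talagrand and Maurey ([cube_transport]), bounds
    E[e^(2 l g)] E[e^(- 2 l g)] by e^(2 l^2 W), and Cauchy-Schwarz gives
    E[e^(l (g(e) - g(not e)))] <= e^(l^2 W) ([cube_antithetic]). Averaging over the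
    pairs ([mean_symmetrize]) and Jensen's inequality in y then yield
    E[exp (l (Z - E Z) - l^2 V)] <= 1 for every real l ([exp_dev_le1]).

    The functional V / (4 b^2) is self-bounding: dropping the i-th coordinate
    decreases it by a number in [0, 1], and these decreases add up to at most the
    functional itself. The entropy method, that is tensorization of entropy
    ([exp_ent_tensor]) followed by Herbst's argument ([poisson_mgf_bound]), gives it
    the exponential moments of a Poisson variable of the same mean, and therefore
    P(V >= v0) <= e^(-t), where v0 is the factor of t under the square root of the
    theorem ([Vsup_tail]).

    Where V < v0 the first exponential bound with l = sqrt (t / v0) or its opposite
    applies, because l * 2 sqrt (t v0) - l^2 v0 = t. So the deviation has probability at
    most 3 e^(-t) ([Zsup_tail]), and this is below the claimed bound since
    (sqrt t - sqrt (ln 2))^2 <= t for t >= ln 2 ([slack_bound]). *)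

(** * Bounded measurable functions and their means *)

Definition bmeas (R : realType) d (T : measurableType d) (f : T -> R) :=
  measurable_fun [set: T] f /\ exists M : R, forall x, `|f x| <= M.

Section bounded_measurable.
Context {R : realType} {d : measure_display} {T : measurableType d}.
Implicit Types f g : T -> R.

Lemma bmeas_cst (c : R) : bmeas (fun _ : T => c).
Proof. by split; [exact: measurable_cst | exists `|c|]. Qed.

Lemma bmeas_ge0 f : bmeas f -> exists2 M : R, 0 <= M & forall x, `|f x| <= M.
Proof.
move=> [_ [M fM]]; exists `|M| => // x.
by rewrite (le_trans (fM x)) ?ler_norm.
Qed.

Lemma bmeasD f g : bmeas f -> bmeas g -> bmeas (fun x => f x + g x).
Proof.
move=> [mf [M fM]] [mg [N gN]]; split; first exact: measurable_funD.
by exists (M + N) => x; rewrite (le_trans (ler_normD _ _)) ?lerD.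
Qed.

Lemma bmeasM f g : bmeas f -> bmeas g -> bmeas (fun x => f x * g x).
Proof.
move=> bf bg; have [M M0 fM] := bmeas_ge0 bf; have [N N0 gN] := bmeas_ge0 bg.
split; first exact: measurable_funM bf.1 bg.1.
by exists (M * N) => x; rewrite normrM ler_pM.
Qed.

Lemma bmeasZ (c : R) f : bmeas f -> bmeas (fun x => c * f x).
Proof. by move=> bf; apply: bmeasM => //; exact: bmeas_cst. Qed.

Lemma bmeasN f : bmeas f -> bmeas (fun x => - f x).
Proof.
move=> bf; rewrite (_ : (fun _ => _) = fun x => -1 * f x); first exact: bmeasZ.
by apply/funext => x; rewrite mulN1r.
Qed.

Lemma bmeasB f g : bmeas f -> bmeas g -> bmeas (fun x => f x - g x).
Proof. by move=> bf bg; apply: bmeasD => //; exact: bmeasN. Qed.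

Lemma bmeas_norm f : bmeas f -> bmeas (fun x => `|f x|).
Proof.
move=> [mf [M fM]]; split; first exact: measurableT_comp.
by exists M => x; rewrite normr_id.
Qed.

Lemma bmeasX f n : bmeas f -> bmeas (fun x => f x ^+ n).
Proof.
move=> bf; elim: n => [|n IH]; 
  first by under eq_fun do rewrite expr0; exact: bmeas_cst.
by under eq_fun do rewrite exprS; exact: bmeasM.
Qed.

Lemma bmeas_sum (I : Type) (r : seq I) (Q : pred I) (f : I -> T -> R) :
  (forall i, bmeas (f i)) -> bmeas (fun x => \sum_(i <- r | Q i) f i x).
Proof.
move=> bf; elim: r => [|i r IH].
  by under eq_fun do rewrite big_nil; exact: bmeas_cst.
under eq_fun do rewrite big_cons.
by case: (Q i) => //; exact: bmeasD.
Qed.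

Lemma bmeas_expR f : bmeas f -> bmeas (fun x => expR (f x)).
Proof.
move=> [mf [M fM]]; split; first exact: measurableT_comp.
exists (expR M) => x; rewrite ger0_norm ?expR_ge0// ler_expR.
exact: le_trans (ler_norm _) (fM x).
Qed.

Lemma bmeas_ln (c : R) f : 0 < c -> (forall x, c <= f x) -> bmeas f ->
  bmeas (fun x => ln (f x)).
Proof.
move=> c0 cf [mf [M fM]]; split.
  by apply: measurableT_comp mf; exact: measurable_ln.
exists (`|ln c| + `|ln M|) => x.
have f0 : 0 < f x := lt_le_trans c0 (cf x).
have fMx : f x <= M := le_trans (ler_norm _) (fM x).
have h1 : ln c <= ln (f x) by rewrite ler_ln ?posrE.
have h2 : ln (f x) <= ln M by rewrite ler_ln ?posrE// (lt_le_trans f0).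
rewrite ler_norml; have := ler_norm (ln M); have := lerNnormlW (lexx `|ln c|).
have := normr_ge0 (ln M); have := normr_ge0 (ln c).
by move=> *; apply/andP; split; lra.
Qed.

Lemma bmeas_comp d' (T' : measurableType d') (g : T' -> R) (phi : T -> T') :
  measurable_fun [set: T] phi -> bmeas g -> bmeas (fun x => g (phi x)).
Proof.
move=> mphi [mg [M gM]]; split; first exact: measurableT_comp mg mphi.
by exists M => x.
Qed.

Lemma bmeas_measurable_ge (c : R) f : bmeas f -> measurable [set x | c <= f x].
Proof.
move=> [mf _]; rewrite -[X in measurable X]setTI.
rewrite (_ : [set x | _] = f @^-1` `[c, +oo[%classic); first exact: mf.
by apply/seteqP; split => x /=; rewrite in_itv/= andbT.
Qed.

Variable P : probability T R.

Lemma bmeas_integrable f : bmeas f -> P.-integrable [set: T] (EFin \o f).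
Proof.
move=> [mf [M fM]]; apply: measurable_bounded_integrable => //.
  by rewrite (@le_lt_trans _ _ 1%E) ?ltry// probability_le1.
exists M; split; first exact: num_real.
by move=> N MN x _; rewrite /= (le_trans (fM x)) ?ltW.
Qed.

Lemma mean_cst (c : R) : \int[P]_x c = c.
Proof. rewrite Rintegral_cst// -[RHS]mulr1; congr (_ * _).
by have /(congr1 fine) := probability_setT P. Qed.

Lemma meanD f g : bmeas f -> bmeas g ->
  \int[P]_x (f x + g x) = \int[P]_x f x + \int[P]_x g x.
Proof. by move=> bf bg; rewrite RintegralD//; exact: bmeas_integrable. Qed.

Lemma meanB f g : bmeas f -> bmeas g ->
  \int[P]_x (f x - g x) = \int[P]_x f x - \int[P]_x g x.
Proof. by move=> bf bg; rewrite RintegralB//; exact: bmeas_integrable. Qed.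

Lemma meanZ (c : R) f : bmeas f -> \int[P]_x (c * f x) = c * \int[P]_x f x.
Proof. by move=> bf; rewrite RintegralZl//; exact: bmeas_integrable. Qed.

Lemma mean_le f g : bmeas f -> bmeas g -> (forall x, f x <= g x) ->
  \int[P]_x f x <= \int[P]_x g x.
Proof. by move=> bf bg fg; apply: le_Rintegral => //; exact: bmeas_integrable. Qed.

Lemma mean_ge (c : R) f : bmeas f -> (forall x, c <= f x) -> c <= \int[P]_x f x.
Proof.
by move=> bf cf; rewrite -[leLHS]mean_cst; apply: mean_le => //; exact: bmeas_cst.
Qed.

Lemma mean_norm_le (M : R) f : bmeas f -> (forall x, `|f x| <= M) ->
  `|\int[P]_x f x| <= M.
Proof.
move=> bf fM; rewrite (le_trans (le_normr_Rintegral _ (bmeas_integrable bf)))//.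
rewrite -[leRHS]mean_cst.
by apply: mean_le => //; [exact: bmeas_norm|exact: bmeas_cst].
Qed.

Lemma mean_sum (I : Type) (r : seq I) (Q : pred I) (f : I -> T -> R) :
  (forall i, bmeas (f i)) ->
  \int[P]_x (\sum_(i <- r | Q i) f i x) = \sum_(i <- r | Q i) \int[P]_x f i x.
Proof.
move=> bf; elim: r => [|i r IH].
  by under eq_Rintegral do rewrite big_nil; rewrite mean_cst big_nil.
under eq_Rintegral do rewrite big_cons; rewrite big_cons.
case: (Q i) => //; rewrite meanD ?IH//; exact: bmeas_sum.
Qed.

(** Jensen's inequality, by integrating the tangent line of [expR] at the mean. *)
Lemma expR_mean_le f : bmeas f -> expR (\int[P]_x f x) <= \int[P]_x expR (f x).
Proof.
move=> bf; set m := \int[P]_x f x.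
have bg : bmeas (fun x => expR m * (1 + (f x - m))).
  apply: bmeasZ; apply: bmeasD; first exact: bmeas_cst.
  by apply: bmeasB => //; exact: bmeas_cst.
have -> : expR m = \int[P]_x (expR m * (1 + (f x - m))).
  rewrite meanZ ?meanD ?meanB ?mean_cst -/m ?subrr ?addr0 ?mulr1//;
    try exact: bmeas_cst.
    by apply: bmeasB => //; exact: bmeas_cst.
  apply: bmeasD; first exact: bmeas_cst.
  by apply: bmeasB => //; exact: bmeas_cst.
apply: mean_le => //; first exact: bmeas_expR.
move=> x; rewrite -[in leRHS](subrKC m (f x)) expRD.
by rewrite ler_wpM2l ?expR_ge0// expR_ge1Dx.
Qed.

(** The form of Chernoff's bound used throughout: the normalization of the
    exponent is part of [f]. *)
Lemma chernoff_le (f : T -> R) (t : R) : bmeas f -> \int[P]_x expR (f x) <= 1 ->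
  (P [set x | (t <= f x)%R] <= (expR (- t))%:E)%E.
Proof.
move=> bf h; pose X : {RV P >-> R} := HB.pack f (isMeasurableFun.Build _ _ _ _ f bf.1).
have := chernoff X t ltr01; rewrite mul1r => /le_trans; apply.
rewrite /mmt_gen_fun expectation_def -[leRHS]mul1e.
apply: lee_pmul => //; first by apply: integral_ge0 => x _; exact: expR_ge0.
rewrite -lee_fin in h; apply: le_trans h.
rewrite /Rintegral fineK; last first.
  by apply: integrable_fin_num => //; apply: bmeas_integrable; exact: bmeas_expR.
rewrite le_eqVlt; apply/orP; left; apply/eqP.
by apply: eq_integral => x _; congr ((expR _)%:E); rewrite /= ?(mulr1, mul1r).
Qed.

End bounded_measurable.

Section fubini_bounded.
Context {R : realType} {d1 d2 : measure_display}.
Context {T1 : measurableType d1} {T2 : measurableType d2}.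
Variables (P1 : probability T1 R) (P2 : probability T2 R).
Variable f : T1 * T2 -> R.
Hypothesis bf : bmeas f.

Lemma bmeas_section1 a : bmeas (fun b => f (a, b)).
Proof. by apply: (bmeas_comp _ bf); exact: pair1_measurable. Qed.

Lemma bmeas_section2 b : bmeas (fun a => f (a, b)).
Proof. by apply: (bmeas_comp _ bf); exact: pair2_measurable. Qed.

Lemma bmeas_mean2 : bmeas (fun a => \int[P2]_b f (a, b)).
Proof.
split.
  apply: measurableT_comp => //.
  have := @measurable_fubini_F _ _ _ _ _ P1 P2 (EFin \o f)
    (bmeas_integrable (P1 \x P2)%E bf).
  exact.
have [M M0 fM] := bmeas_ge0 bf.
by exists M => a; apply: mean_norm_le => //; exact: bmeas_section1.
Qed.

Lemma bmeas_mean1 : bmeas (fun b => \int[P1]_a f (a, b)).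
Proof.
split.
  apply: measurableT_comp => //.
  have := @measurable_fubini_G _ _ _ _ _ P1 P2 (EFin \o f)
    (bmeas_integrable (P1 \x P2)%E bf).
  exact.
have [M M0 fM] := bmeas_ge0 bf.
by exists M => a; apply: mean_norm_le => //; exact: bmeas_section2.
Qed.

Lemma mean_EFin1 a : (\int[P2]_b f (a, b))%:E = (\int[P2]_b (f (a, b))%:E)%E.
Proof.
rewrite fineK//; apply: integrable_fin_num => //.
by apply: bmeas_integrable; exact: bmeas_section1.
Qed.

Lemma mean_prod : \int[(P1 \x P2)%E]_z f z = \int[P1]_a \int[P2]_b f (a, b).
Proof.
congr fine; rewrite -(integral12_prod_meas1 (bmeas_integrable _ bf)).
by apply: eq_integral => a _; rewrite mean_EFin1.
Qed.

Lemma mean_swap :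
  \int[P1]_a \int[P2]_b f (a, b) = \int[P2]_b \int[P1]_a f (a, b).
Proof.
rewrite -mean_prod; congr fine; rewrite -(integral21_prod_meas1 (bmeas_integrable _ bf)).
apply: eq_integral => b _; rewrite fineK//; apply: integrable_fin_num => //.
by apply: bmeas_integrable; exact: bmeas_section2.
Qed.

End fubini_bounded.

(** * Inequalities for the exponential *)

Section real_inequalities.
Context {R : realType}.
Implicit Types x s t : R.

(** The graph of [expR] lies above its tangent line at [u]. *)
Lemma expR_tangent (u v : R) : expR u - expR v <= expR u * (u - v).
Proof.
have := expR_ge1Dx (v - u); rewrite -(ler_pM2l (expR_gt0 u)) -expRD.
by rewrite subrKC => h; lra.
Qed.

Lemma nonpos_of_derive (f df : R -> R) :
  (forall x, is_derive x 1 f (df x)) -> f 0 <= 0 ->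
  (forall x, 0 <= x -> df x <= 0) -> forall x, 0 <= x -> f x <= 0.
Proof.
move=> fd f0 df0 x x0; apply: le_trans f0.
apply: (@ler0_derive1_nincry _ f 0) => //.
- move=> y; rewrite in_itv/= andbT => y0; rewrite derive1E.
  by rewrite (@derive_val _ _ _ _ _ _ _ (fd y)); exact/df0/ltW.
- by apply: derivable_within_continuous => y _; exact: (@ex_derive _ _ _ _ _ _ _ (fd y)).
Qed.

Lemma expR_convex_le (a b s : R) : 0 <= s <= 1 ->
  expR ((1 - s) * a + s * b) <= (1 - s) * expR a + s * expR b.
Proof.
move=> /andP[s0 s1]; set m := (1 - s) * a + s * b.
have ha := expR_tangent m a; have hb := expR_tangent m b.
have s1' : 0 <= 1 - s by rewrite subr_ge0.
have := lerD (ler_wpM2l s1' ha) (ler_wpM2l s0 hb).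
have -> : (1 - s) * (expR m * (m - a)) + s * (expR m * (m - b)) = 0.
  by rewrite /m; ring.
by lra.
Qed.

(** After clearing the denominator, the second derivative of the difference of
    the two sides has the sign of e^x (1 - x) - 1, which is nonpositive. *)
Lemma expR_sub_gamma x : 0 <= x -> 3 > x ->
  expR x - 1 - x <= x ^+ 2 / (2 * (1 - x / 3)).
Proof.
move=> x0 x3; rewrite ler_pdivlMr; last by lra.
pose f (y : R) := (1 - y / 3) * (expR y - 1 - y) - y ^+ 2 / 2.
pose f1 (y : R) := - 3^-1 * (expR y - 1 - y) + (1 - y / 3) * (expR y - 1) - y.
pose f2 (y : R) := 3^-1 * (expR y * (1 - y) - 1).
have d1 (y : R) : is_derive y 1 f (f1 y).
  apply: is_derive_eq; rewrite /f1 /GRing.scale/=; by field.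
have d2 (y : R) : is_derive y 1 f1 (f2 y).
  apply: is_derive_eq; rewrite /f2 /GRing.scale/=; by field.
have f20 (y : R) : 0 <= y -> f2 y <= 0.
  move=> y0; rewrite /f2; have := expR_tangent y 0; rewrite expR0 subr0.
  by lra.
have f10 := nonpos_of_derive d2 _ f20.
have := nonpos_of_derive d1 _ (f10 _) x0; rewrite /f /f1 !expR0.
by move=> h; have := h ltac:(lra) ltac:(lra); lra.
Qed.

Lemma cosh_le_gauss x : 0 <= x -> expR x + expR (- x) <= 2 * expR (x ^+ 2 / 2).
Proof.
move=> x0.
pose k (y : R) := (1 - y) * expR y - (1 + y) * expR (- y).
pose dk (y : R) := y * (expR (- y) - expR y).
pose f (y : R) := (expR y + expR (- y)) * expR (- (y ^+ 2 / 2)) - 2.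
pose df (y : R) := expR (- (y ^+ 2 / 2)) * k y.
have dkP (y : R) : is_derive y 1 k (dk y).
  apply: is_derive_eq; rewrite /dk /GRing.scale/=; by ring.
have dfP (y : R) : is_derive y 1 f (df y).
  apply: is_derive_eq; rewrite /df /k /GRing.scale/=; by field.
have dk0 (y : R) : 0 <= y -> dk y <= 0.
  move=> y0; rewrite /dk; apply: mulr_ge0_le0 => //.
  by rewrite subr_le0 ler_expR; lra.
have k0 := nonpos_of_derive dkP _ dk0.
have df0 (y : R) : 0 <= y -> df y <= 0.
  move=> y0; rewrite /df; apply: mulr_ge0_le0; first exact: expR_ge0.
  by apply: k0 => //; rewrite /k oppr0 expR0; lra.
have := nonpos_of_derive dfP _ df0 x0.
rewrite /f oppr0 expr0n/= mul0r oppr0 expR0 => /(_ ltac:(lra)).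
by rewrite subr_le0 [X in _ * X]expRN ler_pdivrMr ?expR_gt0.
Qed.

End real_inequalities.

(** * Product laws and tensorization of entropy *)

Section tuple_law.
Context {R : realType} {d : measure_display} {T : measurableType d}.
Variable mu : probability T R.

Lemma bmeas_cons n (f : n.+1.-tuple T -> R) : bmeas f ->
  bmeas (fun z : T * n.-tuple T => f [tuple of z.1 :: z.2]).
Proof. by apply: bmeas_comp; exact: measurable_tuple_cons. Qed.

Lemma mean_power_probS n (f : n.+1.-tuple T -> R) : bmeas f ->
  \int[power_prob mu n.+1]_x f x =
  \int[mu]_a \int[power_prob mu n]_x f [tuple of a :: x].
Proof.
move=> bf; have bfc := bmeas_cons bf.
rewrite -(mean_prod mu (power_prob mu n) bfc); congr fine.
rewrite /= integral_distribution//; first by apply: measurableT_comp bf.1.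
exact: bmeas_integrable bfc.
Qed.

Lemma mean_power_prob0 (f : 0.-tuple T -> R) :
  \int[power_prob mu 0]_x f x = f [tuple].
Proof.
rewrite -[RHS](mean_cst (power_prob mu 0)); apply: eq_Rintegral => x _.
by rewrite (tuple0 x).
Qed.

End tuple_law.

Section entropy.
Context {R : realType}.

Definition log_mean_exp d (T : measurableType d) (P : probability T R)
  (g : T -> R) : R := ln (\int[P]_x expR (g x)).

(** The entropy E[Y ln Y] - E[Y] ln E[Y] of the positive function Y = e^g. With
    the logarithm g as the primitive object, positivity of Y comes for free and
    all functions at hand are bounded. *)
Definition exp_ent d (T : measurableType d) (P : probability T R)
  (g : T -> R) : R := \int[P]_x (expR (g x) * (g x - log_mean_exp P g)).

Lemma mean_expR_ge d (T : measurableType d) (P : probability T R) (M : R)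
    (g : T -> R) : bmeas g -> (forall x, `|g x| <= M) ->
  expR (- M) <= \int[P]_x expR (g x).
Proof.
move=> bg gM; apply: mean_ge; first exact: bmeas_expR.
by move=> x; rewrite ler_expR; have := gM x; rewrite ler_norml => /andP[].
Qed.

Lemma expR_log_mean_exp d (T : measurableType d) (P : probability T R)
    (g : T -> R) : bmeas g ->
  expR (log_mean_exp P g) = \int[P]_x expR (g x).
Proof.
move=> bg; rewrite lnK// posrE; have [M M0 gM] := bmeas_ge0 bg.
exact: lt_le_trans (expR_gt0 _) (mean_expR_ge P bg gM).
Qed.

Lemma bmeas_expR_mul d (T : measurableType d) (g h : T -> R) :
  bmeas g -> bmeas h -> bmeas (fun x => expR (g x) * (g x - h x)).
Proof. by move=> bg bh; apply: bmeasM; [exact: bmeas_expR|exact: bmeasB]. Qed.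

(** With y = e^u and z = e^w this is y ln (y / z) - y + z, the nonnegative
    integrand of the variational formula for the entropy: the entropy of e^g is
    the infimum over constants w of the mean of [ent_bound (g x) w]. *)
Definition ent_bound (u w : R) : R := expR u * (u - w) - expR u + expR w.

Lemma bmeas_ent_bound d (T : measurableType d) (g w : T -> R) :
  bmeas g -> bmeas w -> bmeas (fun x => ent_bound (g x) (w x)).
Proof.
move=> bg bw; apply: bmeasD; last exact: bmeas_expR.
by apply: bmeasB; [exact: bmeas_expR_mul|exact: bmeas_expR].
Qed.

(** The two sides differ by [ent_bound L w] with L = [log_mean_exp P g], which is
    nonnegative by convexity of [expR]. *)
Lemma exp_ent_le d (T : measurableType d) (P : probability T R)
    (g : T -> R) (w : R) : bmeas g ->
  exp_ent P g <= \int[P]_x ent_bound (g x) w.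
Proof.
move=> bg; set L := log_mean_exp P g.
have be := bmeas_expR bg.
have bc c : bmeas (fun _ : T => c : R) by exact: bmeas_cst.
have -> : \int[P]_x ent_bound (g x) w =
    exp_ent P g + (expR L * (L - w) - expR L + expR w).
  rewrite /exp_ent -/L.
  transitivity (\int[P]_x (expR (g x) * (g x - L) +
      ((L - w - 1) * expR (g x) + expR w))).
    by apply: eq_Rintegral => x _; rewrite /ent_bound; ring.
  rewrite meanD; first last.
  - by apply: bmeasD => //; exact: bmeasZ.
  - exact: bmeas_expR_mul.
  rewrite meanD//; last exact: bmeasZ.
  by rewrite meanZ// mean_cst -expR_log_mean_exp// -/L; ring.
by have := expR_tangent L w; lra.
Qed.

Section two_factors.
Context d1 d2 (T1 : measurableType d1) (T2 : measurableType d2).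
Variables (P1 : probability T1 R) (P2 : probability T2 R).
Variable g : T1 * T2 -> R.
Hypothesis bg : bmeas g.

Let L0 := ln (\int[P1]_a \int[P2]_b expR (g (a, b))).
Let L1 a := log_mean_exp P2 (fun b => g (a, b)).
Let L2 b := log_mean_exp P1 (fun a => g (a, b)).

Let be : bmeas (fun z => expR (g z)). Proof. exact: bmeas_expR. Qed.

Let bL1 : bmeas L1.
Proof.
have [M _ gM] := bmeas_ge0 bg.
apply: (@bmeas_ln _ _ _ (expR (- M))); first exact: expR_gt0.
  by move=> a; apply: mean_expR_ge => //; exact: bmeas_section1.
exact: bmeas_mean2 be.
Qed.

Let bL2 : bmeas L2.
Proof.
have [M _ gM] := bmeas_ge0 bg.
apply: (@bmeas_ln _ _ _ (expR (- M))); first exact: expR_gt0.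
  by move=> b; apply: mean_expR_ge => //; exact: bmeas_section2.
exact: bmeas_mean1 be.
Qed.

Let bL1z : bmeas (fun z : T1 * T2 => L1 z.1).
Proof. by apply: bmeas_comp bL1; exact: measurable_fst. Qed.

Let bL2z : bmeas (fun z : T1 * T2 => L2 z.2).
Proof. by apply: bmeas_comp bL2; exact: measurable_snd. Qed.

Let e1 : bmeas (fun z : T1 * T2 => expR (g z) * (g z - L1 z.1)).
Proof. exact: bmeas_expR_mul. Qed.

Let e2 : bmeas (fun z : T1 * T2 => expR (g z) * (g z - L2 z.2)).
Proof. exact: bmeas_expR_mul. Qed.

Lemma bmeas_exp_ent1 : bmeas (fun a => exp_ent P2 (fun b => g (a, b))).
Proof. exact: bmeas_mean2 e1. Qed.

Lemma bmeas_exp_ent2 : bmeas (fun b => exp_ent P1 (fun a => g (a, b))).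
Proof. exact: bmeas_mean1 e2. Qed.

(** Subadditivity of entropy over two factors. Writing Y1, Y2 for the marginals
    of Y = e^g and m for its mean, the right side minus the left side is the mean of
    Y ln (Y m / (Y1 Y2)), a relative entropy: it is nonnegative because
    the function Y1 Y2 / m has the same mean as Y. *)
Lemma exp_ent_prod :
  \int[P1]_a \int[P2]_b (expR (g (a, b)) * (g (a, b) - L0)) <=
  \int[P2]_b exp_ent P1 (fun a => g (a, b)) +
  \int[P1]_a exp_ent P2 (fun b => g (a, b)).
Proof.
have [M M0 gM] := bmeas_ge0 bg.
have bL0z : bmeas (fun z : T1 * T2 => L0) by exact: bmeas_cst.
rewrite /exp_ent.
have e0 : bmeas (fun z : T1 * T2 => expR (g z) * (g z - L0)).
  exact: bmeas_expR_mul.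
have eL0 : expR L0 = \int[(P1 \x P2)%E]_z expR (g z).
  rewrite (mean_prod P1 P2 be) lnK// posrE -(mean_prod P1 P2 be).
  exact: lt_le_trans (expR_gt0 _) (mean_expR_ge _ bg gM).
rewrite -(mean_prod P1 P2 e0) -(mean_prod P1 P2 e1).
rewrite -(mean_swap P1 P2 e2) -(mean_prod P1 P2 e2).
rewrite -meanD// -subr_ge0 -meanB//; last exact: bmeasD.
set w := fun z : T1 * T2 => L1 z.1 + L2 z.2 - L0.
have bw : bmeas w by apply: bmeasB => //; exact: bmeasD.
have ew : \int[(P1 \x P2)%E]_z expR (w z) = expR L0.
  rewrite (mean_prod P1 P2 (bmeas_expR bw)).
  have -> : (\int[P1]_a \int[P2]_b expR (w (a, b))) =
     \int[P1]_a (expR L0 * expR (- L0) * expR (L1 a)).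
    apply: eq_Rintegral => a _.
    transitivity (\int[P2]_b (expR (- L0) * expR (L1 a) * expR (L2 b))).
      by apply: eq_Rintegral => b _; rewrite -!expRD; congr expR; rewrite /w/=; ring.
    rewrite meanZ; last exact: bmeas_expR.
    have -> : \int[P2]_b expR (L2 b) = expR L0.
      rewrite eL0 (mean_prod P1 P2 be) (mean_swap P1 P2 be).
      apply: eq_Rintegral => b _; rewrite expR_log_mean_exp//.
      exact: bmeas_section2.
    by ring.
  rewrite meanZ; last exact: bmeas_expR.
  rewrite -expRD subrr expR0 mul1r eL0 (mean_prod P1 P2 be).
  apply: eq_Rintegral => a _; rewrite expR_log_mean_exp//.
  exact: bmeas_section1.
have -> : 0 = \int[(P1 \x P2)%E]_z (expR (g z) - expR (w z)).
  by rewrite meanB ?ew ?eL0 ?subrr//; exact: bmeas_expR.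
apply: mean_le.
- by apply: bmeasB => //; exact: bmeas_expR.
- by apply: bmeasB => //; exact: bmeasD.
- by move=> z; have := expR_tangent (g z) (w z); rewrite /w; lra.
Qed.

End two_factors.

Definition coord_free d (T : measurableType d) n (i : 'I_n) (w : n.-tuple T -> R) :=
  forall x y : n.-tuple T, (forall j, j != i -> tnth x j = tnth y j) -> w x = w y.

(** Tensorization: peel off one coordinate with [exp_ent_prod]; on that coordinate
    [w ord0] is a constant, so that [exp_ent_le] applies. *)
Lemma exp_ent_tensor d (T : measurableType d) (mu : probability T R) n
    (g : n.-tuple T -> R) (w : 'I_n -> n.-tuple T -> R) :
  bmeas g -> (forall i, bmeas (w i)) -> (forall i, coord_free i (w i)) ->
  exp_ent (power_prob mu n) g <=
  \int[power_prob mu n]_x \sum_(i < n) ent_bound (g x) (w i x).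
Proof.
elim: n g w => [|n IH] g w bg bw cw.
  rewrite mean_power_prob0 big_ord0 /exp_ent /log_mean_exp !mean_power_prob0.
  by rewrite expRK subrr mulr0.
have bgc := bmeas_cons bg.
have bt i : bmeas (fun x => ent_bound (g x) (w i x)) by exact: bmeas_ent_bound.
have btc i := bmeas_cons (bt i).
have bs := bmeas_sum (index_enum 'I_n) xpredT (fun i => btc (lift ord0 i)).
have bmul L : bmeas (fun x => expR (g x) * (g x - L)).
  by apply: bmeas_expR_mul => //; exact: bmeas_cst.
rewrite /exp_ent /log_mean_exp (mean_power_probS mu (bmeas_expR bg)).
rewrite (mean_power_probS mu (bmul _)).
rewrite (mean_power_probS mu (bmeas_sum (index_enum _) xpredT bt)).
apply: le_trans (exp_ent_prod mu (power_prob mu n) bgc) _ => /=.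
have -> : \int[mu]_a \int[power_prob mu n]_x
    \sum_(i < n.+1) ent_bound (g [tuple of a :: x]) (w i [tuple of a :: x]) =
  \int[power_prob mu n]_x \int[mu]_a
    ent_bound (g [tuple of a :: x]) (w ord0 [tuple of a :: x]) +
  \int[mu]_a \int[power_prob mu n]_x \sum_(i < n)
    ent_bound (g [tuple of a :: x]) (w (lift ord0 i) [tuple of a :: x]).
  rewrite -(mean_swap mu (power_prob mu n) (btc ord0)).
  rewrite -(meanD mu (bmeas_mean2 mu _ (btc ord0)) (bmeas_mean2 mu _ bs)).
  apply: eq_Rintegral => a _.
  rewrite -(meanD _ (bmeas_section1 (btc ord0) a) (bmeas_section1 bs a)).
  by apply: eq_Rintegral => x _; rewrite big_ord_recl.
apply: lerD; apply: mean_le.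
- exact: (bmeas_exp_ent2 mu (power_prob mu n) bgc).
- exact: (bmeas_mean1 mu (power_prob mu n) (btc ord0)).
- move=> x; have wE a : w ord0 [tuple of a :: x] = w ord0 [tuple of point :: x].
    apply: cw => j.
    by case: (unliftP ord0 j) => [k ->|->]; rewrite ?eqxx// !tnthS.
  under [leRHS]eq_Rintegral do rewrite wE.
  exact: exp_ent_le (bmeas_section2 bgc x).
- exact: (bmeas_exp_ent1 mu (power_prob mu n) bgc).
- exact: (bmeas_mean2 mu (power_prob mu n) bs).
- move=> a; apply: IH.
  + exact: bmeas_section1 bgc a.
  + by move=> i; exact: bmeas_section1 (bmeas_cons (bw (lift ord0 i))) a.
  + move=> i x y xy; apply: cw => j.
    case: (unliftP ord0 j) => [k ->|->]; last by rewrite !tnth0.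
    by rewrite !tnthS (inj_eq lift_inj); exact: xy.
Qed.

End entropy.

(** * Herbst's argument and self-bounding functions *)

Section herbst.
Context {R : realType} {d : measure_display} {T : measurableType d}.
Variables (P : probability T R) (v : T -> R).
Hypothesis bv : bmeas v.

Let bexp th : bmeas (fun x => expR (th * v x)).
Proof. by apply: bmeas_expR; exact: bmeasZ. Qed.

Let bvexp th : bmeas (fun x => v x * expR (th * v x)).
Proof. exact: bmeasM. Qed.

Lemma is_derive_mgf (th : R) :
  is_derive th 1 (fun th => \int[P]_x expR (th * v x))
    (\int[P]_x (v x * expR (th * v x))).
Proof.
have [M M0 vM] := bmeas_ge0 bv.
pose f (a : R) (x : T) := expR (a * v x).
have df (a : R) (x : T) : is_derive a 1 (f ^~ x) (v x * expR (a * v x)).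
  by rewrite /f; apply: is_derive_eq; rewrite /GRing.scale/=; ring.
have dfE (a : R) (x : T) : partial1of2 f a x = v x * expR (a * v x).
  by rewrite /partial1of2 derive1E (@derive_val _ _ _ _ _ _ _ (df a x)).
pose G (x : T) := M * expR ((`|th| + 1) * M).
have thI : `]th - 1, th + 1[%classic th by rewrite /= in_itv/= ltrBlDr ltrDl ltr01.
have intf (a : R) : `]th - 1, th + 1[%classic a ->
  P.-integrable setT (EFin \o f a).
  by move=> _; apply (bmeas_integrable P (bexp a)).
have G0 x : 0 <= G x by rewrite mulr_ge0// expR_ge0.
have intG : P.-integrable setT (EFin \o G).
  by apply: (bmeas_integrable P); exact: bmeas_cst.
have dG (a : R) x : `]th - 1, th + 1[%classic a -> setT x ->
    `|partial1of2 f a x| <= G x.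
  rewrite /= in_itv/= => /andP[a1 a2] _; rewrite dfE normrM ler_pM//.
  rewrite ger0_norm ?expR_ge0// ler_expR (le_trans (ler_norm _))// normrM.
  rewrite ler_pM// ler_norml; have := ler_norm th; have := lerNnormlW (lexx `|th|).
  by move=> *; apply/andP; split; lra.
have dd (a : R) x : `]th - 1, th + 1[%classic a -> setT x ->
    derivable (f ^~ x) a 1.
  by move=> _ _; exact: (@ex_derive _ _ _ _ _ _ _ (df a x)).
have D1 := derivable_under_integral measurableT thI intf dd G0 intG dG.
have D2 := differentiation_under_integral measurableT thI intf dd G0 intG dG.
apply: DeriveDef => //; rewrite -derive1E D2.
by apply: eq_Rintegral => x _; rewrite dfE.
Qed.

Hypothesis v0 : forall x, 0 <= v x.
Hypothesis ent_ineq : forall th : R, 0 < th ->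
  (1 - expR (- th)) * \int[P]_x (v x * expR (th * v x)) <=
  (\int[P]_x expR (th * v x)) * ln (\int[P]_x expR (th * v x)).

(** Herbst's argument. The hypothesis [ent_ineq] says that the derivative of
    ln E[e^(th v)] / (e^th - 1) is nonpositive for th > 0, so this quotient is at
    most its limit at 0, the mean of v. The limit is replaced by the explicit
    bound m + O(a) for the quotient at small a. *)
Lemma poisson_mgf_bound (th : R) : 0 <= th ->
  \int[P]_x expR (th * v x) <= expR ((expR th - 1) * \int[P]_x v x).
Proof.
set m := \int[P]_x v x.
have m0 : 0 <= m by exact: mean_ge.
have [M M0 vM] := bmeas_ge0 bv.
pose F (th : R) := \int[P]_x expR (th * v x).
pose dF (th : R) := \int[P]_x (v x * expR (th * v x)).
have F1 a : 0 <= a -> 1 <= F a.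
  by move=> a0; apply: mean_ge => // x; rewrite -expR0 ler_expR mulr_ge0.
rewrite le_eqVlt => /predU1P[<-|th0].
  under eq_Rintegral do rewrite mul0r expR0.
  by rewrite mean_cst expR0 subrr mul0r expR0.
pose r (a : R) := ln (F a) * (expR a - 1)^-1.
pose dr (a : R) := (dF a / F a) * (expR a - 1)^-1 -
  ln (F a) * (expR a * (expR a - 1) ^- 2).
have eN0 (a : R) : 0 < a -> 0 < expR a - 1.
  by move=> a0; rewrite subr_gt0 -expR0 ltr_expR.
have F_gt0 a : 0 < a -> 0 < F a by move=> a0; rewrite (lt_le_trans ltr01)// F1// ltW.
have rP (a : R) : 0 < a -> is_derive a 1 r (dr a).
  move=> a0; have dFa : is_derive a 1 F (dF a) by exact: is_derive_mgf.
  have dlF : is_derive a 1 (fun a => ln (F a)) (dF a / F a).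
    have hl := is_derive1_ln (F_gt0 _ a0).
    by apply: is_derive_eq; rewrite mulrC.
  have ne : expR a - 1 != 0 by rewrite gt_eqF// eN0.
  have dinv : is_derive a 1 (fun a => (expR a - 1)^-1)
      (- (expR a - 1) ^- 2 * expR a).
    have dd : is_derive a 1 (fun a : R => expR a - 1) (expR a).
      by apply: is_derive_eq; rewrite subr0.
    exact: (@is_deriveV R (fun a : R => expR a - 1) a _ 1 ne dd).
  by apply: is_derive_eq; rewrite /dr /GRing.scale/=; ring.
have dr0 (a : R) : 0 < a -> dr a <= 0.
  move=> a0; have := ent_ineq a0; rewrite -/(F a) -/(dF a) => h.
  have ea := eN0 _ a0; have Fa := F_gt0 _ a0.
  have -> : dr a = (expR a * ((1 - expR (- a)) * dF a - F a * ln (F a))) /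
     (F a * (expR a - 1) ^+ 2).
    have /eqP eNE : expR a * expR (- a) = 1 by rewrite -expRD subrr expR0.
    rewrite mulrBr mulrA mulrBr mulr1 (eqP eNE) /dr.
    by field; rewrite !gt_eqF.
  apply: mulr_le0_ge0; last by rewrite invr_ge0 mulr_ge0 ?sqr_ge0// ltW.
  by apply: mulr_ge0_le0; [exact: expR_ge0|rewrite subr_le0].
have r_small (a : R) : 0 < a -> a <= th -> r a <= m + a * (M * expR (th * M) * m).
  move=> a0 ath.
  have h1 : r a <= (F a - 1) / a.
    rewrite /r ler_pM//; first by rewrite ln_ge0// F1// ltW.
    - by rewrite invr_ge0 ltW// eN0.
    - by rewrite -ler_expR lnK ?posrE ?F_gt0//; have := expR_ge1Dx (F a - 1); lra.
    - by rewrite lef_pV2 ?posrE ?eN0//; have := expR_ge1Dx a; lra.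
  apply: le_trans h1 _; rewrite ler_pdivrMr//.
  have h2 : F a - 1 <= \int[P]_x ((a * expR (a * M)) * v x).
    rewrite -(mean_cst P 1) -meanB//; last exact: bmeas_cst.
    apply: mean_le; [by apply: bmeasB => //; exact: bmeas_cst|exact: bmeasZ|].
    move=> x; have := expR_tangent (a * v x) 0; rewrite expR0 subr0 => /le_trans; apply.
    rewrite mulrC -!mulrA ler_wpM2l ?(ltW a0)// mulrC ler_wpM2r// ler_expR.
    by rewrite ler_wpM2l ?(ltW a0)// (le_trans (ler_norm _)).
  apply: le_trans h2 _; rewrite meanZ// -/m.
  have h3 : expR (a * M) <= 1 + a * (M * expR (th * M)).
    have := expR_tangent (a * M) 0; rewrite expR0 subr0.
    have : expR (a * M) * (a * M) <= expR (th * M) * (a * M).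
      by rewrite ler_wpM2r ?ler_expR ?ler_wpM2r ?mulr_ge0 ?(ltW a0).
    by lra.
  have := ler_wpM2l (mulr_ge0 (ltW a0) m0) h3.
  set X := expR _; set Y := expR _.
  have -> : (m + a * (M * Y * m)) * a = a * m * (1 + a * (M * Y)) by ring.
  by rewrite mulrAC.
have r_th : r th <= m.
  apply/ler_addgt0Pr => e e0; set C := M * expR (th * M) * m.
  have C0 : 0 <= C by rewrite !mulr_ge0 ?expR_ge0.
  pose a := Num.min th (e / (C + 1)).
  have a0 : 0 < a by rewrite lt_min th0 divr_gt0//; lra.
  have ath : a <= th by rewrite ge_min lexx.
  have aC : a * C <= e.
    have : a <= e / (C + 1) by rewrite ge_min lexx orbT.
    rewrite ler_pdivlMr; last by lra.
    by have := ltW a0; lra.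
  have rr : r th <= r a.
    apply: (@ler0_derive1_le_cc _ r a th).
    - move=> x; rewrite in_itv/= => /andP[ax _].
      exact: (@ex_derive _ _ _ _ _ _ _ (rP _ (lt_trans a0 ax))).
    - move=> x; rewrite in_itv/= => /andP[ax _].
      rewrite derive1E (@derive_val _ _ _ _ _ _ _ (rP _ (lt_trans a0 ax))).
      exact/dr0/(lt_trans a0 ax).
    - apply: derivable_within_continuous => x; rewrite in_itv/= => /andP[ax _].
      exact: (@ex_derive _ _ _ _ _ _ _ (rP _ (lt_le_trans a0 ax))).
    - by rewrite in_itv/= lexx ath.
    - by rewrite in_itv/= lexx ath.
    - by [].
  by have := r_small _ a0 ath; rewrite -/C; lra.
rewrite -/(F th) -[leLHS](@lnK _ (F th)) ?posrE ?F_gt0// ler_expR.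
by rewrite mulrC -ler_pdivrMr ?eN0.
Qed.

End herbst.

Section self_bounding.
Context {R : realType} {d : measure_display} {T : measurableType d}.
Variables (mu : probability T R) (n : nat).
Variables (v : n.-tuple T -> R) (w : 'I_n -> n.-tuple T -> R).
Hypothesis bv : bmeas v.
Hypothesis bw : forall i, bmeas (w i).
Hypothesis cw : forall i, coord_free i (w i).
Hypothesis vw : forall i x, 0 <= v x - w i x <= 1.
Hypothesis v_sum : forall x, \sum_(i < n) (v x - w i x) <= v x.
Let P := power_prob mu n.

(** Take w i as comparison functions in [exp_ent_tensor]. With s = v - w i in
    [0, 1] the i-th term is e^(th v) (th s - 1 + e^(- th s)), which by convexity is
    at most s (th - 1 + e^(- th)) e^(th v); summing over i with [v_sum] leaves
    exactly the differential inequality needed by [poisson_mgf_bound]. *)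
Lemma self_bounding_mgf (th : R) : 0 <= th ->
  \int[P]_x expR (th * v x) <= expR ((expR th - 1) * \int[P]_x v x).
Proof.
apply: poisson_mgf_bound => //.
  move=> x; apply: le_trans (v_sum x); apply: sumr_ge0 => i _.
  by have /andP[] := vw i x.
move=> {}th th0.
have bg : bmeas (fun x => th * v x) by exact: bmeasZ.
have bh i : bmeas (fun x => th * w i x) by exact: bmeasZ.
have ch i : coord_free i (fun x => th * w i x).
  by move=> x y xy; rewrite (cw xy).
have bve : bmeas (fun x => v x * expR (th * v x)).
  by apply: bmeasM => //; exact: bmeas_expR.
set F := \int[P]_x _; set G := \int[P]_x _.
have entE : exp_ent P (fun x => th * v x) = th * F - G * ln G.
  rewrite /exp_ent /log_mean_exp -/G.
  transitivity (\int[P]_x (th * (v x * expR (th * v x)) - ln G * expR (th * v x))).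
    by apply: eq_Rintegral => x _; ring.
  rewrite meanB; try (by apply: bmeasZ => //; exact: bmeas_expR).
  by rewrite !meanZ//; [rewrite -/F -/G; ring|exact: bmeas_expR].
have := exp_ent_tensor mu bg bh ch; rewrite -/P entE => hent.
suff : \int[P]_x \sum_(i < n) ent_bound (th * v x) (th * w i x) <=
    (th - 1 + expR (- th)) * F by lra.
rewrite -meanZ//; apply: mean_le.
- apply: (bmeas_sum _ _ (fun i => bmeas_ent_bound bg (bh i))).
- exact: bmeasZ.
move=> x; set c := th - 1 + expR (- th).
have c0 : 0 <= c by have := expR_ge1Dx (- th); rewrite /c; lra.
apply: (@le_trans _ _ (\sum_(i < n) (c * expR (th * v x)) * (v x - w i x))).
  apply: ler_sum => i _; set s := v x - w i x.
  have sI : 0 <= s <= 1 by exact: vw.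
  have := expR_convex_le 0 (- th) sI; rewrite mulr0 add0r expR0 mulr1 => hc.
  have -> : ent_bound (th * v x) (th * w i x) =
      expR (th * v x) * (th * s - 1 + expR (s * - th)).
    rewrite /ent_bound.
    have -> : th * w i x = th * v x + s * - th by rewrite /s; ring.
    by rewrite expRD; ring.
  rewrite -mulrA mulrCA ler_wpM2l ?expR_ge0// /c.
  by move: hc; lra.
rewrite -mulr_sumr -mulrA ler_wpM2l// mulrC ler_wpM2r ?expR_ge0//.
Qed.

(** Chernoff's bound at Bernstein's parameter th = s / (m + s / 3), for which
    [expR_sub_gamma] gives the exponent s^2 / (2 (m + s / 3)); the equation for s
    says that this exponent is t. *)
Lemma self_bounding_tail (s t : R) : 0 < s ->
  s ^+ 2 = 2 * t * \int[P]_x v x + 2 * t * s / 3 ->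
  (P [set x | (\int[P]_x v x + s <= v x)%R] <= (expR (- t))%:E)%E.
Proof.
set m := \int[P]_x v x => s0 sE.
have m0 : 0 <= m.
  apply: mean_ge => // x; apply: le_trans (v_sum x); apply: sumr_ge0 => i _.
  by have /andP[] := vw i x.
have [th [th0 hth]] : exists th : R, 0 <= th /\
    t <= th * s - (expR th - 1 - th) * m.
  have [m_gt0|m_le0] := ltP 0 m; last first.
    have mE : m = 0 by lra.
    (* The mean is 0, so s = 2 t / 3 and the term th * s alone must reach t. *)
    exists (3 / 2); split; first by lra.
    rewrite mE mulr0 subr0; move: sE; rewrite mE mulr0 add0r => sE.
    suff : s = 2 * t / 3 by lra.
    apply: (mulfI (lt0r_neq0 s0)); rewrite -expr2 sE; ring.
  pose q := m + s / 3; have q0 : 0 < q by rewrite /q; lra.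
  have tE : t = s ^+ 2 / (2 * q).
    by rewrite sE /q; field; rewrite gt_eqF// -/q; lra.
  (* Then th * s = 2 t, and the sub-gamma bound of the remaining term is t. *)
  exists (s / q); split; first by rewrite divr_ge0 ?ltW.
  have h3 : s / q < 3 by rewrite ltr_pdivrMr// /q; lra.
  have := expR_sub_gamma (divr_ge0 (ltW s0) (ltW q0)) h3.
  have -> : (s / q) ^+ 2 / (2 * (1 - s / q / 3)) = s ^+ 2 / (2 * q) / m.
    have -> : 1 - s / q / 3 = m / q.
      by rewrite /q; field; rewrite gt_eqF// -/q; lra.
    by field; rewrite !gt_eqF.
  rewrite ler_pdivlMr// -tE => h.
  have -> : s / q * s = 2 * t by rewrite tE; field; rewrite gt_eqF.
  by lra.
pose f x := th * v x - (expR th - 1) * m.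
have bf : bmeas f by apply: bmeasB; [exact: bmeasZ|exact: bmeas_cst].
have fE : \int[P]_x expR (f x) <= 1.
  rewrite /f; under eq_Rintegral do rewrite expRD mulrC expRN.
  rewrite meanZ; last by apply: bmeas_expR; exact: bmeasZ.
  by rewrite mulrC ler_pdivrMr ?expR_gt0// mul1r self_bounding_mgf.
apply: le_trans (chernoff_le t bf fE).
apply: le_measure; rewrite ?inE.
- exact: bmeas_measurable_ge.
- exact: bmeas_measurable_ge.
- by move=> x /= h; rewrite /f; have := ler_wpM2l th0 h; lra.
Qed.

End self_bounding.

(** * Convex transport on the discrete cube *)

Section cube.
Context {R : realType}.

(** Vertices of the cube {0,1}^n are words of length [n]; untyped words and the
    recursion on the first letter make every induction on [n] immediate. *)
Fixpoint cube_avg n (h : seq bool -> R) : R :=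
  if n is m.+1 then
    (cube_avg m (fun e => h (true :: e)) + cube_avg m (fun e => h (false :: e))) / 2
  else h [::].

Lemma cube_avg_lin n (a b : R) (h k : seq bool -> R) :
  cube_avg n (fun e => a * h e + b * k e) = a * cube_avg n h + b * cube_avg n k.
Proof. by elim: n h k => [|n IH] h k //=; rewrite !IH; field. Qed.

Lemma cube_avgZ n (a : R) (h : seq bool -> R) :
  cube_avg n (fun e => a * h e) = a * cube_avg n h.
Proof. by elim: n h => [|n IH] h //=; rewrite !IH; field. Qed.

Lemma cube_avg_le n (h k : seq bool -> R) :
  (forall e, size e = n -> h e <= k e) -> cube_avg n h <= cube_avg n k.
Proof.
elim: n h k => [|n IH] h k hk /=; first exact: hk.
by rewrite ler_wpM2r// lerD// IH// => e sz; apply: hk; rewrite /= sz.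
Qed.

Lemma cube_avg_expR_gt0 n (h : seq bool -> R) :
  0 < cube_avg n (fun e => expR (h e)).
Proof.
elim: n h => [|n IH] h /=; first exact: expR_gt0.
by rewrite divr_gt0// addr_gt0// IH.
Qed.

Lemma cube_avg_negb n (h : seq bool -> R) :
  cube_avg n (fun e => h (map negb e)) = cube_avg n h.
Proof.
elim: n h => [|n IH] h //=.
by rewrite (IH (fun e => h (false :: e))) (IH (fun e => h (true :: e))) addrC.
Qed.

Lemma eq_cube_avg n (h k : seq bool -> R) :
  (forall e, h e = k e) -> cube_avg n h = cube_avg n k.
Proof. by move=> hk; congr cube_avg; apply/funext. Qed.

(** Hoelder's inequality, with normalized factors: the pointwise convexity of
    [expR] becomes an inequality between averages. *)
Lemma cube_avg_holder n (s l m : R) (q r : seq bool -> R) : 0 <= s <= 1 ->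
  cube_avg n (fun e => expR (q e)) <= expR (- l) ->
  cube_avg n (fun e => expR (r e)) <= expR (- m) ->
  cube_avg n (fun e => expR ((1 - s) * q e + s * r e)) <=
    expR (- ((1 - s) * l + s * m)).
Proof.
move=> sI ql rm; have /andP[s0 s1] := sI.
have s1' : 0 <= 1 - s by rewrite subr_ge0.
set k := (1 - s) * l + s * m.
apply: (@le_trans _ _ (cube_avg n (fun e =>
    (expR (- k) * (1 - s) * expR l) * expR (q e) +
    (expR (- k) * s * expR m) * expR (r e)))).
  apply: cube_avg_le => e _.
  have -> : (1 - s) * q e + s * r e =
      - k + ((1 - s) * (l + q e) + s * (m + r e)) by rewrite /k; ring.
  rewrite expRD -!mulrA -mulrDr ler_wpM2l ?expR_ge0// -!expRD.
  exact: expR_convex_le.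
rewrite cube_avg_lin -!mulrA -mulrDr -[leRHS]mulr1 ler_wpM2l ?expR_ge0//.
have normalized x h : cube_avg n h <= expR (- x) -> expR x * cube_avg n h <= 1.
  by move=> hx; rewrite -ler_pdivlMl ?expR_gt0// mulr1 -expRN.
apply: (@le_trans _ _ ((1 - s) * 1 + s * 1)); last by rewrite !mulr1 subrK.
by apply: lerD; apply: ler_wpM2l => //; exact: normalized.
Qed.

Lemma half_half (x y : R) : x * y <= 4 -> x / 2 * (y / 2) <= 1.
Proof. by lra. Qed.

(** The difference of the two sides is at least (s - (x - y))^2 / 2: this is the
    bound s Delta - s^2/2 <= Delta^2/2 for moving a weight s along an edge. *)
Lemma mix_lower (s x y v q r : R) : 0 <= s <= 1 ->
  x - v / 2 <= q -> y - v / 2 <= r ->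
  x - ((x - y) ^+ 2 + v) / 2 <= (1 - s) * q + s * r + s ^+ 2 / 2.
Proof.
move=> /andP[s0 s1] xq yr; have s1' : 0 <= 1 - s by rewrite subr_ge0.
have := lerD (ler_wpM2l s1' xq) (ler_wpM2l s0 yr).
by have := sqr_ge0 (s - (x - y)); lra.
Qed.

(** The case n = 1 of the transport inequality, where x and y are the logarithms
    of the means of e^(-h) over the two halves of the cube. With u = y - x the left
    side is (1 + e^(s^2/2 + (1 - s) u)) (1 + e^(- u)). For u <= 1 the choice s = u gives
    4 e^(- u^2/4) cosh(u/2) cosh(v/2) with v = u - u^2/2 in [0, u], and
    cosh z <= e^(z^2/2) closes it; for u >= 1 the choice s = 1 is dominated by the
    case u = 1. *)
Lemma two_point (x y : R) : x <= y -> exists2 s, 0 <= s <= 1 &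
  (expR (s ^+ 2 / 2 - (1 - s) * x - s * y) + expR (- y)) * (expR x + expR y) <= 4.
Proof.
have key (u : R) : 0 <= u <= 1 ->
    (1 + expR (u - u ^+ 2 / 2)) * (1 + expR (- u)) <= 4.
  move=> /andP[u0 u1]; set v := u - u ^+ 2 / 2.
  have v0 : 0 <= v by rewrite /v; nra.
  have vu : v <= u by rewrite /v; nra.
  have hc (z : R) : expR (z / 2) * (expR (z / 2) + expR (- (z / 2))) = 1 + expR z.
    by rewrite mulrDr -!expRD subrr expR0 addrC; congr (_ + expR _); field.
  have cu : expR (u / 2) + expR (- (u / 2)) <= 2 * expR (u ^+ 2 / 8).
    have := @cosh_le_gauss _ (u / 2) ltac:(lra).
    by have -> : (u / 2) ^+ 2 / 2 = u ^+ 2 / 8 by field.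
  have cv : expR (v / 2) + expR (- (v / 2)) <= 2 * expR (u ^+ 2 / 8).
    have := @cosh_le_gauss _ (v / 2) ltac:(lra) => /le_trans; apply.
    by rewrite ler_wpM2l// ler_expR; nra.
  rewrite -(hc v) -(hc (- u)).
  have -> : - (- u / 2) = u / 2 by field.
  have -> : - u / 2 = - (u / 2) by field.
  rewrite [X in _ * (_ * X)]addrC mulrACA -expRD.
  apply: (@le_trans _ _ (expR (v / 2 + - (u / 2)) *
      (2 * expR (u ^+ 2 / 8) * (2 * expR (u ^+ 2 / 8))))).
    by rewrite ler_wpM2l ?expR_ge0// ler_pM// addr_ge0// expR_ge0.
  have -> : 2 * expR (u ^+ 2 / 8) * (2 * expR (u ^+ 2 / 8)) =
      4 * expR (u ^+ 2 / 8 + u ^+ 2 / 8) by rewrite expRD; ring.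
  rewrite mulrCA -expRD -[leRHS]mulr1 ler_wpM2l//.
  by rewrite -expR0 ler_expR /v; nra.
move=> xy; set u := y - x; have u0 : 0 <= u by rewrite subr_ge0.
have scale (s : R) :
    (expR (s ^+ 2 / 2 - (1 - s) * x - s * y) + expR (- y)) * (expR x + expR y) =
    (1 + expR (s ^+ 2 / 2 + (1 - s) * u)) * (1 + expR (- u)).
  have -> : s ^+ 2 / 2 - (1 - s) * x - s * y = - y + (s ^+ 2 / 2 + (1 - s) * u).
    by rewrite /u; ring.
  have -> : expR x = expR y * expR (- u).
    by rewrite -expRD; congr expR; rewrite /u; ring.
  have e1 : expR y * expR (- y) = 1 by rewrite -expRD subrr expR0.
  rewrite expRD; set E := expR (_ + _); set U := expR (- u).
  transitivity (expR y * expR (- y) * ((1 + E) * (1 + U))); first by ring.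
  by rewrite e1 mul1r.
have [u1|u1] := leP u 1.
  exists u; first by rewrite u0.
  rewrite scale; have -> : u ^+ 2 / 2 + (1 - u) * u = u - u ^+ 2 / 2 by field.
  by apply: key; rewrite u0.
exists 1; first by rewrite ler01 lexx.
rewrite scale; have := key 1; rewrite ler01 lexx => /(_ isT); apply: le_trans.
have -> : 1 ^+ 2 / 2 + (1 - 1) * u = 1 - 1 ^+ 2 / 2 :> R by field.
by rewrite ler_wpM2l ?addr_ge0 ?expR_ge0// lerD2l ler_expR lerN2 ltW.
Qed.

Definition cube_affine n (c : R) (a : nat -> bool -> R) (e : seq bool) : R :=
  c + \sum_(i < n) a i (nth false e i).

Lemma cube_affineS n c a b e :
  cube_affine n.+1 c a (b :: e) = cube_affine n (c + a 0%N b) (fun i => a i.+1) e.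
Proof. by rewrite /cube_affine big_ord_recl/= addrA. Qed.

Definition cube_var n (a : nat -> bool -> R) : R :=
  \sum_(i < n) (a i true - a i false) ^+ 2.

(** A form of Maurey's convex infimum-convolution inequality. The function q plays
    the role of the infimum, over probability measures nu on the cube, of
    (int h dnu) + 1/2 sum_i nu(e'_i <> e_i)^2, as a function of e. All that is
    needed of that infimum is the exponential inequality and the lower bound on q
    by affine minorants of h, and both survive induction on n. Of the two half-cubes, the one where
    the mean of e^(-h) is smaller gets the mixture with weight s of the two
    functions q, at the cost s^2/2; the other one keeps its own q. The
    exponential moment of the mixture is controlled by [cube_avg_holder], its
    affine minorants by [mix_lower], and [two_point] makes the costs balance. *)
Lemma cube_transport n (h : seq bool -> R) : exists q : seq bool -> R,
  cube_avg n (fun e => expR (q e)) * cube_avg n (fun e => expR (- h e)) <= 1 /\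
  forall c a, (forall e, size e = n -> cube_affine n c a e <= h e) ->
    forall e, size e = n -> cube_affine n c a e - cube_var n a / 2 <= q e.
Proof.
elim: n h => [|n IH] h.
  exists h; split; first by rewrite /= -expRD subrr expR0.
  move=> c a ha e sz; rewrite /cube_var big_ord0 mul0r subr0; exact: ha.
have {IH}[q qP] : exists q : bool -> seq bool -> R, forall b,
    cube_avg n (fun e => expR (q b e)) *
      cube_avg n (fun e => expR (- h (b :: e))) <= 1 /\
    forall c a, (forall e, size e = n -> cube_affine n c a e <= h (b :: e)) ->
      forall e, size e = n -> cube_affine n c a e - cube_var n a / 2 <= q b e.
  have [q1 q1P] := IH (fun e => h (true :: e)).
  have [q0 q0P] := IH (fun e => h (false :: e)).
  by exists (fun b => if b then q1 else q0) => -[].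
pose p b := cube_avg n (fun e => expR (- h (b :: e))).
have p0 b : 0 < p b by exact: cube_avg_expR_gt0.
pose l b := ln (p b).
have pE b : p b = expR (l b) by rewrite lnK ?posrE.
have qp b : cube_avg n (fun e => expR (q b e)) <= expR (- l b).
  by rewrite expRN -pE -[_^-1]mul1r ler_pdivlMr//; case: (qP b).
(* The half-cube [b0] is the one on which the mean of e^(-h) is smaller. *)
have [b0 lb0] : exists b0, l b0 <= l (~~ b0).
  by have [h1|/ltW h1] := leP (l true) (l false); [exists true|exists false].
have [s sI hs] := two_point lb0.
pose mix e := (1 - s) * q b0 e + s * q (~~ b0) e + s ^+ 2 / 2.
pose Q e := if e is b :: e' then (if b == b0 then mix e' else q b e') else 0.
exists Q; split.
  have Qmix : cube_avg n (fun e => expR (mix e)) <=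
      expR (s ^+ 2 / 2 - (1 - s) * l b0 - s * l (~~ b0)).
    rewrite /mix.
    under eq_cube_avg do rewrite addrC expRD.
    rewrite cube_avgZ -addrA expRD ler_wpM2l ?expR_ge0// -opprD.
    exact: cube_avg_holder.
  have avgS (f : seq bool -> R) : cube_avg n.+1 f =
      (cube_avg n (fun e => f (b0 :: e)) + cube_avg n (fun e => f (~~ b0 :: e))) / 2.
    by rewrite /=; case: (b0) => //=; rewrite addrC.
  rewrite !avgS /Q eqxx (negbTE (_ : ~~ b0 != b0)); last by case: (b0).
  rewrite -/(p b0) -/(p (~~ b0)) !pE.
  have := qp (~~ b0) => h2; have := lerD Qmix h2 => h3.
  have := ler_wpM2r (addr_ge0 (expR_ge0 (l b0)) (expR_ge0 (l (~~ b0)))) h3.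
  by move=> /le_trans/(_ hs); exact: half_half.
move=> c a ha [//|b e] [sz].
have hb b' : cube_affine n (c + a 0%N b') (fun i => a i.+1) e -
    cube_var n (fun i => a i.+1) / 2 <= q b' e.
  apply: (qP b').2 => // e' sz'; rewrite -cube_affineS; apply: ha.
  by rewrite /= sz'.
have varE : cube_var n.+1 a =
    (a 0%N b0 - a 0%N (~~ b0)) ^+ 2 + cube_var n (fun i => a i.+1).
  rewrite /cube_var big_ord_recl; congr (_ + _).
  by case: (b0) => //=; rewrite -sqrrN opprB.
have slopeE : a 0%N b0 - a 0%N (~~ b0) =
    cube_affine n (c + a 0%N b0) (fun i => a i.+1) e -
    cube_affine n (c + a 0%N (~~ b0)) (fun i => a i.+1) e.
  by rewrite /cube_affine opprD addrACA subrr addr0 opprD addrACA subrr add0r.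
rewrite cube_affineS varE /Q; case: eqVneq => [->|bb0].
  by rewrite slopeE; exact: mix_lower.
have -> : b = ~~ b0 by move: bb0; case: (b); case: (b0).
apply: le_trans (hb _); rewrite lerB// ler_wpM2r//.
by rewrite lerDr sqr_ge0.
Qed.

(** Here [g] is the supremum of the affine functions [a f]. Applied to h = 2 lam g,
    [cube_transport] gives E[e^(2 lam g)] E[e^(- 2 lam g)] <= e^(2 lam^2 W), and the
    two factors e^(lam g(e)) and e^(- lam g(not e)), which are dependent, are separated
    by the Cauchy-Schwarz inequality. *)
Lemma cube_antithetic n (I : Type) (J : set I) (a : I -> nat -> bool -> R)
    (g : seq bool -> R) (W lam : R) :
  (forall f e, J f -> size e = n -> cube_affine n 0 (a f) e <= g e) ->
  (forall e (r : R), size e = n -> 0 < r ->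
    exists2 f, J f & g e - r <= cube_affine n 0 (a f) e) ->
  (forall f, J f -> cube_var n (a f) <= W) ->
  cube_avg n (fun e => expR (lam * (g e - g (map negb e)))) <=
    expR (lam ^+ 2 * W).
Proof.
move=> ag ga aW.
wlog lam0 : lam / 0 <= lam.
  move=> H; have [|/ltW lam0] := leP 0 lam; first exact: H.
  have := H (- lam); rewrite oppr_ge0 sqrrN => /(_ lam0).
  rewrite -[X in X <= _ -> _]cube_avg_negb; apply: le_trans.
  apply: cube_avg_le => e _; rewrite (mapK negbK) ler_expR; lra.
have [q [qh hq]] := cube_transport n (fun e => 2 * lam * g e).
have qg e : size e = n -> 2 * lam * g e - 2 * lam ^+ 2 * W <= q e.
  move=> sz; apply/ler_addgt0Pr => r r0.
  have l1 : 0 < 2 * lam + 1 by lra.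
  have [f Jf gf] := ga e _ sz (divr_gt0 r0 l1).
  have affE e' : cube_affine n 0 (fun i b => 2 * lam * a f i b) e' =
      2 * lam * cube_affine n 0 (a f) e'.
    by rewrite /cube_affine !add0r mulr_sumr.
  have varE : cube_var n (fun i b => 2 * lam * a f i b) =
      (2 * lam) ^+ 2 * cube_var n (a f).
    by rewrite /cube_var mulr_sumr; apply: eq_bigr => i _; ring.
  have := hq 0 (fun i b => 2 * lam * a f i b) _ e sz.
  rewrite affE varE => hh.
  have {}hh : 2 * lam * cube_affine n 0 (a f) e -
      (2 * lam) ^+ 2 * cube_var n (a f) / 2 <= q e.
    by apply: hh => e' sz'; rewrite affE ler_wpM2l ?mulr_ge0// ag.
  have h1 : 2 * lam * (g e - r / (2 * lam + 1)) <= 2 * lam * cube_affine n 0 (a f) e.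
    by rewrite ler_wpM2l ?mulr_ge0.
  have h2 : 2 * lam * (r / (2 * lam + 1)) <= r.
    by rewrite mulrA ler_pdivrMr//; have := ltW r0; lra.
  have h3 : 2 * lam ^+ 2 * cube_var n (a f) <= 2 * lam ^+ 2 * W.
    by rewrite ler_wpM2l ?mulr_ge0 ?sqr_ge0 ?aW.
  by lra.
set A := cube_avg n (fun e => expR (2 * lam * g e)).
set B := cube_avg n (fun e => expR (- (2 * lam * g e))).
have A0 : 0 < A by exact: cube_avg_expR_gt0.
have B0 : 0 < B by exact: cube_avg_expR_gt0.
have AB : A * B <= expR (2 * (lam ^+ 2 * W)).
  have hA : A * expR (- (2 * (lam ^+ 2 * W))) <= cube_avg n (fun e => expR (q e)).
    rewrite mulrC -cube_avgZ; apply: cube_avg_le => e sz.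
    by rewrite -expRD ler_expR; have := qg e sz; lra.
  have := le_trans (ler_wpM2r (ltW B0) hA) qh.
  by rewrite expRN mulrAC ler_pdivrMr ?expR_gt0// mul1r.
(* The factor e^k balances the two means in the arithmetic-geometric inequality. *)
pose k := (ln A - ln B) / 2.
have lnAB : ln A + ln B <= 2 * (lam ^+ 2 * W).
  by rewrite -lnM ?posrE// -ler_expR lnK// posrE mulr_gt0.
apply: (@le_trans _ _ (cube_avg n (fun e =>
   (2^-1 * expR (- k)) * expR (2 * lam * g e) +
   (2^-1 * expR k) * expR (- (2 * lam * g (map negb e)))))).
  apply: cube_avg_le => e _.
  have hI : 0 <= (2^-1 : R) <= 1 by apply/andP; split; lra.
  have -> : lam * (g e - g (map negb e)) = (1 - 2^-1) * (2 * lam * g e - k) +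
      2^-1 * (- (2 * lam * g (map negb e)) + k) by field.
  apply: le_trans (expR_convex_le _ _ hI) _.
  by rewrite !expRD le_eqVlt; apply/orP; left; apply/eqP; field.
rewrite cube_avg_lin (cube_avg_negb n (fun e => expR (- (2 * lam * g e)))) -/A -/B.
rewrite -[A]lnK ?posrE// -[in X in _ + X](@lnK _ B) ?posrE// -!mulrA -!expRD.
have -> : - k + ln A = (ln A + ln B) / 2 by rewrite /k; field.
have -> : k + ln B = (ln A + ln B) / 2 by rewrite /k; field.
apply: (@le_trans _ _ (expR ((ln A + ln B) / 2))); last by rewrite ler_expR; lra.
by rewrite le_eqVlt; apply/orP; left; apply/eqP; field.
Qed.

End cube.

(** * Suprema over a countable class, and exchange of coordinates *)

Section suprema.
Context {R : realType} {I : Type} (F : set I) (h : I -> R) (M : R).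
Hypothesis F0 : F !=set0.
Hypothesis hM : forall f, F f -> `|h f| <= M.

Let S := [set h f | f in F].

Let hasS : has_sup S.
Proof.
split; first by have [f Ff] := F0; exists (h f), f.
by exists M => _ [f Ff <-]; exact: le_trans (ler_norm _) (hM Ff).
Qed.

Lemma sup_image_ge f : F f -> h f <= sup S.
Proof. by move=> Ff; apply: (sup_upper_bound hasS); exists f. Qed.

Lemma sup_image_le (c : R) : (forall f, F f -> h f <= c) -> sup S <= c.
Proof.
move=> hc; apply: ge_sup => [|_ [f Ff <-]]; last exact: hc.
by have [f Ff] := F0; exists (h f), f.
Qed.

Lemma sup_image_approx (r : R) : 0 < r -> exists2 f, F f & sup S - r <= h f.
Proof.
by move=> r0; have [_ [f Ff <-] /ltW] := sup_adherent r0 hasS; exists f.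
Qed.

Lemma sup_image_norm_le : `|sup S| <= M.
Proof.
rewrite ler_norml; have [f Ff] := F0; apply/andP; split.
  apply: le_trans (sup_image_ge Ff); have := hM Ff.
  by rewrite ler_norml => /andP[].
by apply: sup_image_le => g Fg; exact: le_trans (ler_norm _) (hM Fg).
Qed.

End suprema.

(** Countability turns the supremum into one over a sequence running
    through the class. *)
Lemma bmeas_sup {R : realType} (I : Type) (F : set I) d (T : measurableType d)
    (h : I -> T -> R) (M : R) : countable F -> F !=set0 ->
  (forall f, F f -> measurable_fun [set: T] (h f)) ->
  (forall f x, F f -> `|h f x| <= M) ->
  bmeas (fun x => sup [set h f x | f in F]).
Proof.
move=> cF [f0 Ff0] mh hM; split; last first.
  by exists M => x; apply: sup_image_norm_le; [exists f0|move=> f; exact: hM].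
have [iota inj_iota] := countable_injP _ cF.
(* [f0] fills the codes that no member of the class uses. *)
have : forall k : nat, exists f, F f /\ forall g, F g -> iota g = k -> g = f.
  move=> k; have [[g [Fg gk]]|ng] := pselect (exists g, F g /\ iota g = k).
    exists g; split=> // g' Fg' g'k; apply: inj_iota; rewrite ?inE//.
    by rewrite gk.
  by exists f0; split=> // g Fg gk; exfalso; apply: ng; exists g.
move=> /choice[u uP].
have uF k : F (u k) := (uP k).1.
have -> : (fun x => sup [set h f x | f in F]) =
          (fun x => sups ((fun k => h (u k)) ^~ x) 0).
  apply/funext => x; rewrite /sups /sdrop; congr sup; apply/seteqP; split.
    by move=> _ [f Ff <-]; exists (iota f) => //=; rewrite -((uP (iota f)).2 f Ff).
  by move=> _ [k _ <-]; exists (u k).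
apply: measurable_fun_sups => [x _|k]; last exact: mh.
by exists M => _ [k _ <-]; exact: le_trans (ler_norm _) (hM _ _ (uF k)).
Qed.

Section swapping.
Context {R : realType} {d : measure_display} {T : measurableType d}.

Definition splice n (e : seq bool) (x y : n.-tuple T) : n.-tuple T :=
  [tuple (if nth false e i then tnth x i else tnth y i) | i < n].

Lemma tnth_splice n e (x y : n.-tuple T) i :
  tnth (splice e x y) i = if nth false e i then tnth x i else tnth y i.
Proof. by rewrite tnth_mktuple. Qed.

Lemma splice_cons n b e (a c : T) (x y : n.-tuple T) :
  splice (b :: e) [tuple of a :: x] [tuple of c :: y] =
  [tuple of (if b then a else c) :: splice e x y].
Proof.
apply: eq_from_tnth => i; rewrite tnth_splice.
by case: (unliftP ord0 i) => [j ->|->]; rewrite ?tnthS ?tnth_splice ?tnth0.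
Qed.

Lemma measurable_splice n e : measurable_fun [set: n.-tuple T * n.-tuple T]
  (fun z => splice e z.1 z.2).
Proof.
apply/measurable_fun_tnthP => i.
rewrite (_ : _ \o _ = fun z : n.-tuple T * n.-tuple T =>
   if nth false e i then tnth z.1 i else tnth z.2 i); last first.
  by apply/funext => z /=; rewrite tnth_splice.
case: (nth false e i).
  by apply: (measurableT_comp (measurable_tnth i)); exact: measurable_fst.
by apply: (measurableT_comp (measurable_tnth i)); exact: measurable_snd.
Qed.

Definition exchange n (e : seq bool) (z : n.-tuple T * n.-tuple T) :=
  (splice e z.1 z.2, splice (map negb e) z.1 z.2).

Lemma measurable_exchange n e :
  measurable_fun [set: n.-tuple T * n.-tuple T] (exchange e).
Proof. by apply/measurable_fun_pairP; split; exact: measurable_splice. Qed.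

Variable mu : probability T R.

(** The pair (x_i, y_i) is exchangeable, independently over i. By induction on [n]
    the statement reduces to Fubini's theorem for the two first coordinates. *)
Lemma mean_exchange n (e : seq bool) (G : n.-tuple T * n.-tuple T -> R) :
  bmeas G -> size e = n ->
  \int[(power_prob mu n \x power_prob mu n)%E]_z G (exchange e z) =
  \int[(power_prob mu n \x power_prob mu n)%E]_z G z.
Proof.
elim: n e G => [|n IH] e G bG.
  move=> _; apply: eq_Rintegral => -[x y] _ /=.
  by rewrite /exchange (tuple0 x) (tuple0 y) !(tuple0 (splice _ _ _)).
case: e => [//|b e] [sz].
pose P := power_prob mu n.
have bGs : bmeas (fun z => G (exchange (b :: e) z)).
  by apply: bmeas_comp bG; exact: measurable_exchange.
have cons2 (H : n.+1.-tuple T * n.+1.-tuple T -> R) : bmeas H ->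
  \int[(power_prob mu n.+1 \x power_prob mu n.+1)%E]_z H z =
  \int[mu]_a \int[mu]_c \int[(P \x P)%E]_z
     H ([tuple of a :: z.1], [tuple of c :: z.2]).
  move=> bH; rewrite (mean_prod _ _ bH).
  rewrite (mean_power_probS mu (bmeas_mean2 (power_prob mu n.+1) _ bH)).
  apply: eq_Rintegral => a _.
  have b3 : bmeas (fun q : (n.-tuple T * T) * n.-tuple T =>
      H ([tuple of a :: q.1.1], [tuple of q.1.2 :: q.2])).
    apply: bmeas_comp bH; apply/measurable_fun_pairP; split.
      by apply: measurable_cons => //; apply: measurableT_comp.
    by apply: measurable_cons => //; apply: measurableT_comp.
  transitivity (\int[P]_x \int[mu]_c \int[P]_y
      H ([tuple of a :: x], [tuple of c :: y])).
    apply: eq_Rintegral => x _.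
    exact: mean_power_probS (bmeas_section1 bH [tuple of a :: x]).
  rewrite (mean_swap _ _ (bmeas_mean2 (P \x mu)%E P b3)) /=.
  apply: eq_Rintegral => c _; rewrite (mean_prod P P (f := fun z =>
    H ([tuple of a :: z.1], [tuple of c :: z.2])))//.
  apply: (bmeas_comp
    (phi := fun z : n.-tuple T * n.-tuple T => ((z.1, c), z.2)) _ b3).
  apply/measurable_fun_pairP; split; last exact: measurable_snd.
  by apply/measurable_fun_pairP; split; [exact: measurable_fst|exact: measurable_cst].
rewrite (cons2 _ bGs) (cons2 _ bG).
have b4 : bmeas (fun q : (T * T) * (n.-tuple T * n.-tuple T) =>
    G ([tuple of q.1.1 :: q.2.1], [tuple of q.1.2 :: q.2.2])).
  apply: bmeas_comp bG; apply/measurable_fun_pairP; split;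
    by apply: measurable_cons; apply: measurableT_comp.
have bGac a c : bmeas (fun z : n.-tuple T * n.-tuple T =>
    G ([tuple of a :: z.1], [tuple of c :: z.2])).
  exact: bmeas_section1 b4 (a, c).
pose K a c := \int[(P \x P)%E]_z G ([tuple of a :: z.1], [tuple of c :: z.2]).
have bK : bmeas (fun ac : T * T => K ac.1 ac.2).
  exact: (bmeas_mean2 (mu \x mu)%E (P \x P)%E b4).
have -> : \int[mu]_a \int[mu]_c \int[(P \x P)%E]_z
    G (exchange (b :: e) ([tuple of a :: z.1], [tuple of c :: z.2])) =
  \int[mu]_a \int[mu]_c \int[(P \x P)%E]_z
    G ([tuple of (if b then a else c) :: z.1],
       [tuple of (if b then c else a) :: z.2]).
  apply: eq_Rintegral => a _; apply: eq_Rintegral => c _.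
  rewrite -(IH e _ (bGac _ _) sz).
  apply: eq_Rintegral => z _; rewrite /exchange /= !splice_cons.
  by rewrite if_neg.
clear bGs; case: b; first by [].
have sw : \int[mu]_a \int[mu]_c K a c = \int[mu]_c \int[mu]_a K a c.
  exact: (mean_swap mu mu (f := fun ac => K ac.1 ac.2)).
exact: esym sw.
Qed.

Lemma bmeas_cube_avg d' (T' : measurableType d') n (H : seq bool -> T' -> R) :
  (forall e, bmeas (H e)) -> bmeas (fun x => cube_avg n (fun e => H e x)).
Proof.
elim: n H => [|n IH] H bH /=; first exact: bH.
apply: bmeasM; last exact: bmeas_cst.
by apply: bmeasD; apply: (IH (fun e => H (_ :: e))).
Qed.

Lemma mean_cube_avg d' (T' : measurableType d') (P : probability T' R) n
    (H : seq bool -> T' -> R) : (forall e, bmeas (H e)) ->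
  \int[P]_x cube_avg n (fun e => H e x) = cube_avg n (fun e => \int[P]_x H e x).
Proof.
elim: n H => [|n IH] H bH //=.
have bA b := bmeas_cube_avg n (fun e => bH (b :: e)).
rewrite -(IH (fun e => H (true :: e)))// -(IH (fun e => H (false :: e)))//.
rewrite -meanD// mulrC -meanZ; last exact: bmeasD.
by apply: eq_Rintegral => x _; rewrite mulrC.
Qed.

Lemma cube_avg_cst n (c : R) (h : seq bool -> R) :
  (forall e, size e = n -> h e = c) -> cube_avg n h = c.
Proof.
move=> hc; have cc : cube_avg n (fun=> c) = c.
  by elim: (n) => [|m IH] //=; rewrite IH; lra.
rewrite -[RHS]cc; apply/eqP; rewrite eq_le.
by rewrite !cube_avg_le// => e /hc ->.
Qed.

Lemma mean_symmetrize n (G : n.-tuple T * n.-tuple T -> R) : bmeas G ->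
  \int[(power_prob mu n \x power_prob mu n)%E]_z G z =
  \int[(power_prob mu n \x power_prob mu n)%E]_z
    cube_avg n (fun e => G (exchange e z)).
Proof.
move=> bG; rewrite (mean_cube_avg _ n (H := fun e z => G (exchange e z))); last first.
  by move=> e; apply: bmeas_comp bG; exact: measurable_exchange.
by apply/esym/cube_avg_cst => e; exact: mean_exchange.
Qed.

End swapping.

(** * The empirical process *)

Section empirical_process.
Context {R : realType} {d : measure_display} {T : measurableType d}.
Variables (mu : probability T R) (n : nat) (b : R) (F : set (T -> R)).
Hypothesis b0 : 0 < b.
Hypothesis cF : countable F.
Hypothesis F0 : F !=set0.
Hypothesis mF : forall f, F f -> measurable_fun [set: T] f.
Hypothesis bF : forall f, F f -> forall w, - b <= f w <= b.

Let P := power_prob mu n.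
Let PP := (P \x P)%E.
Let sample := n.-tuple T.

(** The predicate [Q] serves the self-bounding property of V, which compares it
    with the functionals that omit one coordinate. *)
Definition sq_dev (Q : pred 'I_n) (f : T -> R) (z : sample * sample) : R :=
  \sum_(i < n | Q i) (f (tnth z.1 i) - f (tnth z.2 i)) ^+ 2.

Definition sup_sq_dev (Q : pred 'I_n) (z : sample * sample) : R :=
  sup [set sq_dev Q f z | f in F].

Let sq_le f x y : F f -> (f x - f y) ^+ 2 <= 4 * b ^+ 2.
Proof.
move=> Ff; have /andP[x1 x2] := bF Ff x; have /andP[y1 y2] := bF Ff y.
have : 0 <= (2 * b - (f x - f y)) * (2 * b + (f x - f y)).
  by apply: mulr_ge0; lra.
by lra.
Qed.

Let sq_dev_ge0 Q f z : 0 <= sq_dev Q f z.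
Proof. by apply: sumr_ge0 => i _; exact: sqr_ge0. Qed.

Let sq_dev_norm Q f z : F f ->
  `|sq_dev Q f z| <= \sum_(i < n | Q i) (4 * b ^+ 2).
Proof.
by move=> Ff; rewrite ger0_norm//; apply: ler_sum => i _; exact: sq_le.
Qed.

Let sum_norm f (x : sample) : F f ->
  `|\sum_(i < n) f (tnth x i)| <= \sum_(i < n) b.
Proof.
move=> Ff; apply: le_trans (ler_norm_sum _ _ _) _; apply: ler_sum => i _.
by rewrite ler_norml; exact: bF.
Qed.

Let bmeas_F f : F f -> bmeas f.
Proof.
by move=> Ff; split; [exact: mF|exists b => w; rewrite ler_norml; exact: bF].
Qed.

Lemma bmeas_Zsup : bmeas (Zsup F : sample -> R).
Proof.
apply: (bmeas_sup cF F0) => [f Ff|f x Ff]; last exact: sum_norm.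
apply: (bmeas_sum _ _ _).1 => i.
by apply: bmeas_comp (bmeas_F Ff); exact: measurable_tnth.
Qed.

Lemma bmeas_sup_sq_dev Q : bmeas (sup_sq_dev Q).
Proof.
apply: (bmeas_sup cF F0) => [f Ff|f x Ff]; last exact: sq_dev_norm.
apply: (bmeas_sum _ _ _).1 => i; apply: bmeasX.
by apply: bmeasB; apply: bmeas_comp (bmeas_F Ff);
  apply: (measurableT_comp (measurable_tnth i)).
Qed.

Let sq_dev_le_sup Q f z : F f -> sq_dev Q f z <= sup_sq_dev Q z.
Proof.
move=> Ff; apply: (sup_image_ge (h := fun f => sq_dev Q f z) F0) => // h.
exact: sq_dev_norm.
Qed.

Lemma VsupE x : Vsup mu F x = \int[P]_y sup_sq_dev xpredT (x, y).
Proof. by rewrite /Vsup unlock. Qed.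

Lemma bmeas_Vsup : bmeas (Vsup mu F : sample -> R).
Proof.
rewrite (_ : Vsup mu F = fun x => \int[P]_y sup_sq_dev xpredT (x, y)).
  exact: (bmeas_mean2 P P (bmeas_sup_sq_dev _)).
by apply/funext => x; exact: VsupE.
Qed.

(** This invariance lets the quadratic term leave the average over
    exchanges of coordinates. *)
Lemma sup_sq_dev_exchange e z : size e = n ->
  sup_sq_dev xpredT (exchange e z) = sup_sq_dev xpredT z.
Proof.
move=> sz; congr sup; apply: eq_imagel => f _.
apply: eq_bigr => i _; rewrite /= !tnth_splice (nth_map false) ?sz//.
by case: (nth false e i) => //=; rewrite -sqrrN opprB.
Qed.

(** Fix the pairs {x_i, y_i} and average over all exchanges: Z is then a supremum
    of affine functions on the cube, of squared slope at most W, and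
    [cube_antithetic] bounds the average by 1. *)
Lemma exp_pair_le1 (lam : R) :
  \int[PP]_z expR (lam * (Zsup F z.1 - Zsup F z.2) -
                    lam ^+ 2 * sup_sq_dev xpredT z) <= 1.
Proof.
set G := fun z : sample * sample => expR _.
have bZ1 : bmeas (fun z : sample * sample => Zsup F z.1).
  by apply: bmeas_comp bmeas_Zsup; exact: measurable_fst.
have bZ2 : bmeas (fun z : sample * sample => Zsup F z.2).
  by apply: bmeas_comp bmeas_Zsup; exact: measurable_snd.
have bG : bmeas G.
  apply: bmeas_expR; apply: bmeasB; apply: bmeasZ; last exact: bmeas_sup_sq_dev.
  exact: bmeasB.
rewrite -/(\int[PP]_z G z) mean_symmetrize// -[leRHS](mean_cst PP).
apply: mean_le.
- apply: bmeas_cube_avg => e; apply: bmeas_comp bG; exact: measurable_exchange.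
- exact: bmeas_cst.
move=> z; pose g e := Zsup F (splice e z.1 z.2).
pose W := sup_sq_dev xpredT z.
apply: (@le_trans _ _ (cube_avg n (fun e =>
    expR (- (lam ^+ 2 * W)) * expR (lam * (g e - g (map negb e)))))).
  apply: cube_avg_le => e sz.
  by rewrite /G sup_sq_dev_exchange// -expRD [- _ + _]addrC.
rewrite cube_avgZ expRN ler_pdivrMl ?expR_gt0// mulr1.
pose a (f : T -> R) (i : nat) (c : bool) : R :=
  if c then f (nth point z.1 i) else f (nth point z.2 i).
have affE f e : cube_affine n 0 (a f) e = \sum_(i < n) f (tnth (splice e z.1 z.2) i).
  rewrite /cube_affine add0r; apply: eq_bigr => i _.
  by rewrite tnth_splice /a !(tnth_nth point); case: (nth false e i).
apply: (@cube_antithetic _ _ _ F a) => [f e Ff _|e r _ r0|f Ff].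
- rewrite affE; apply: (sup_image_ge (M := \sum_(i < n) b) F0) => // h Fh.
  exact: sum_norm.
- have [|f Ff hf] := sup_image_approx
     (h := fun f => \sum_(i < n) f (tnth (splice e z.1 z.2) i))
     (M := \sum_(i < n) b) F0 _ r0.
    by move=> h Fh; exact: sum_norm.
  by exists f => //; rewrite affE.
- have -> : cube_var n (a f) = sq_dev xpredT f z.
    by apply: eq_bigr => i _; rewrite /a !(tnth_nth point).
  exact: sq_dev_le_sup.
Qed.

(** Jensen's inequality in y, applied to [exp_pair_le1]. *)
Lemma exp_dev_le1 (lam : R) :
  \int[P]_x expR (lam * (Zsup F x - \int[P]_y Zsup F y) -
                   lam ^+ 2 * Vsup mu F x) <= 1.
Proof.
apply: le_trans (exp_pair_le1 lam).
have bZ := bmeas_Zsup; have bW := bmeas_sup_sq_dev xpredT.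
have bg : bmeas (fun z : sample * sample =>
    lam * (Zsup F z.1 - Zsup F z.2) - lam ^+ 2 * sup_sq_dev xpredT z).
  apply: bmeasB; apply: bmeasZ => //; apply: bmeasB.
    by apply: bmeas_comp bZ; exact: measurable_fst.
  by apply: bmeas_comp bZ; exact: measurable_snd.
rewrite (mean_prod P P (bmeas_expR bg)); apply: mean_le.
- apply: bmeas_expR; apply: bmeasB; apply: bmeasZ; last exact: bmeas_Vsup.
  by apply: bmeasB => //; exact: bmeas_cst.
- exact: (bmeas_mean2 P P (bmeas_expR bg)).
move=> x; apply: le_trans (expR_mean_le P (bmeas_section1 bg x)) => /=.
have bWx := bmeas_section1 bW x.
have bZx : bmeas (fun y : sample => Zsup F x - Zsup F y).
  by apply: bmeasB => //; exact: bmeas_cst.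
rewrite meanB; [|exact: bmeasZ..].
by rewrite !meanZ// meanB ?mean_cst ?VsupE//; exact: bmeas_cst.
Qed.

Let drop_one (i : 'I_n) := [pred j : 'I_n | j != i].

Let sup_drop i z : 0 <= sup_sq_dev xpredT z - sup_sq_dev (drop_one i) z <= 4 * b ^+ 2.
Proof.
have devE f : sq_dev xpredT f z =
    (f (tnth z.1 i) - f (tnth z.2 i)) ^+ 2 + sq_dev (drop_one i) f z.
  by rewrite /sq_dev (bigD1 i).
apply/andP; split.
  rewrite subr_ge0; apply: (sup_image_le F0) => f Ff.
  by have := sq_dev_le_sup xpredT z Ff; apply: le_trans; rewrite devE lerDr sqr_ge0.
rewrite lerBlDr; apply: (sup_image_le F0) => f Ff.
by rewrite devE lerD ?sq_le ?sq_dev_le_sup.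
Qed.

(** For a single f the omitted squares add up to the whole sum, so it suffices to
    evaluate at an almost maximizing f. *)
Let sup_drop_sum z :
  \sum_(i < n) (sup_sq_dev xpredT z - sup_sq_dev (drop_one i) z) <=
  sup_sq_dev xpredT z.
Proof.
apply/ler_addgt0Pr => r r0.
have n1 : 0 < n%:R + 1 :> R by rewrite ltr_wpDl.
have [|f Ff hf] := sup_image_approx (h := fun f => sq_dev xpredT f z)
    (M := \sum_(i < n) (4 * b ^+ 2)) F0 _ (divr_gt0 r0 n1).
  by move=> h Fh; exact: sq_dev_norm.
apply: (@le_trans _ _ (\sum_(i < n)
    ((f (tnth z.1 i) - f (tnth z.2 i)) ^+ 2 + r / (n%:R + 1)))).
  apply: ler_sum => i _; have := sq_dev_le_sup (drop_one i) z Ff.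
  move: hf; rewrite -/(sup_sq_dev xpredT z) {1}/sq_dev (bigD1 i)//=.
  rewrite -/(sq_dev (drop_one i) f z).
  by lra.
rewrite big_split/= sumr_const card_ord; apply: lerD.
  exact: (sq_dev_le_sup xpredT).
rewrite -[leLHS]mulr_natr mulrAC ler_pdivrMr//.
by have := ltW r0; lra.
Qed.

Lemma mean_Vsup_ge0 : 0 <= \int[P]_x Vsup mu F x.
Proof.
apply: mean_ge => [|x]; first exact: bmeas_Vsup.
rewrite VsupE; apply: mean_ge => [|y].
  exact: (bmeas_section1 (bmeas_sup_sq_dev _) x).
have [f Ff] := F0; apply: le_trans (sq_dev_ge0 xpredT f (x, y)) _.
exact: sq_dev_le_sup.
Qed.

(** The function V / (4 b^2) is self-bounding with respect to the functionals that
    omit one coordinate, and the excess of the threshold over EV, divided by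
    4 b^2, solves the quadratic equation of [self_bounding_tail]. *)
Lemma Vsup_tail (t EV : R) : 0 < t -> EV = \int[P]_x Vsup mu F x ->
  (P [set x | (EV + 2 * b / 3 * Num.sqrt (18 * EV * t + 4 * b ^+ 2 * t ^+ 2)
                + 4 * b ^+ 2 * t / 3 <= Vsup mu F x)%R] <= (expR (- t))%:E)%E.
Proof.
move=> t0 EVE; pose K := 4 * b ^+ 2.
have K0 : 0 < K by rewrite mulr_gt0 ?exprn_gt0.
have bV := bmeas_Vsup.
pose v (x : sample) := K^-1 * Vsup mu F x.
pose w i (x : sample) := K^-1 * \int[P]_y sup_sq_dev (drop_one i) (x, y).
have bv : bmeas v by exact: bmeasZ.
have bWi i : bmeas (fun x : sample => \int[P]_y sup_sq_dev (drop_one i) (x, y)).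
  exact: (bmeas_mean2 P P (bmeas_sup_sq_dev _)).
have bw i : bmeas (w i) by exact: bmeasZ.
have cw i : coord_free i (w i).
  move=> x y xy; congr (_ * _); apply: eq_Rintegral => u _.
  congr sup; apply: eq_imagel => f _; apply: eq_bigr => j ji.
  by rewrite /= xy.
have vwE i x : v x - w i x = K^-1 * \int[P]_y
    (sup_sq_dev xpredT (x, y) - sup_sq_dev (drop_one i) (x, y)).
  rewrite meanB; [|exact: (bmeas_section1 (bmeas_sup_sq_dev _) x)..].
  by rewrite /v /w VsupE mulrBr.
have bdiff i x : bmeas (fun y =>
    sup_sq_dev xpredT (x, y) - sup_sq_dev (drop_one i) (x, y)).
  by apply: bmeasB; exact: (bmeas_section1 (bmeas_sup_sq_dev _) x).
have vw i x : 0 <= v x - w i x <= 1.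
  rewrite vwE; apply/andP; split.
    rewrite mulr_ge0 ?invr_ge0 ?(ltW K0)//; apply: mean_ge => // y.
    by have /andP[] := sup_drop i (x, y).
  rewrite ler_pdivrMl// mulr1 -(mean_cst P K).
  apply: mean_le => //; first exact: bmeas_cst.
  by move=> y; have /andP[] := sup_drop i (x, y).
have vs x : \sum_(i < n) (v x - w i x) <= v x.
  under eq_bigr do rewrite vwE.
  rewrite -mulr_sumr /v ler_pM2l ?invr_gt0// VsupE -mean_sum//.
  apply: mean_le; first exact: bmeas_sum.
    exact: (bmeas_section1 (bmeas_sup_sq_dev _) x).
  by move=> y; exact: sup_drop_sum.
have EvE : \int[P]_x v x = EV / K by rewrite meanZ// mulrC EVE.
have EV0 : 0 <= EV by rewrite EVE; exact: mean_Vsup_ge0.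
set D := Num.sqrt _.
have D2 : D ^+ 2 = 18 * EV * t + 4 * b ^+ 2 * t ^+ 2.
  rewrite sqr_sqrtr//; have h1 := mulr_ge0 EV0 (ltW t0).
  by have h2 := mulr_ge0 (sqr_ge0 b) (sqr_ge0 t); lra.
have D0 : 0 <= D by exact: sqrtr_ge0.
pose s := (2 * b / 3 * D + 4 * b ^+ 2 * t / 3) / K.
have s0 : 0 < s.
  rewrite divr_gt0// ltr_wpDl//; first by rewrite !mulr_ge0 ?invr_ge0 ?(ltW b0).
  by rewrite !mulr_gt0 ?invr_gt0 ?exprn_gt0.
have sE : s ^+ 2 = 2 * t * \int[P]_x v x + 2 * t * s / 3.
  rewrite EvE; have KE : K = 4 * b ^+ 2 by [].
  have sE : s = (D / b + 2 * t) / 6.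
    by rewrite /s KE; field; rewrite gt_eqF.
  rewrite sE KE.
  have -> : ((D / b + 2 * t) / 6) ^+ 2 =
      (D ^+ 2 / b ^+ 2 + 4 * t * D / b + 4 * t ^+ 2) / 36.
    by field; rewrite gt_eqF.
  by rewrite D2; field; rewrite gt_eqF.
apply: le_trans (self_bounding_tail bv bw cw vw vs s0 sE).
apply: le_measure; rewrite ?inE; try exact: bmeas_measurable_ge.
move=> x /= h; rewrite EvE /v /s -mulrDl [leRHS]mulrC ler_pM2r ?invr_gt0//.
by rewrite addrA.
Qed.

(** Let v0 be the threshold of [Vsup_tail]. Where V < v0, a deviation
    |Z - EZ| >= 2 sqrt (t v0) forces l (Z - EZ) - l^2 V >= t for one of the two values
    l = sqrt (t / v0) and l = - sqrt (t / v0); each of the three events has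
    probability at most e^(-t). *)
Lemma Zsup_tail (t EZ EV : R) : 0 < t ->
  EZ = \int[P]_x Zsup F x -> EV = \int[P]_x Vsup mu F x ->
  (P [set x | (2 * Num.sqrt (t * (EV
                + 2 * b / 3 * Num.sqrt (18 * EV * t + 4 * b ^+ 2 * t ^+ 2)
                + 4 * b ^+ 2 * t / 3)) <= `|Zsup F x - EZ|)%R]
   <= (3 * expR (- t))%:E)%E.
Proof.
move=> t0 EZE EVE; set v0 := EV + _ + _.
have bZ := bmeas_Zsup; have bV := bmeas_Vsup.
have EV0 : 0 <= EV by rewrite EVE; exact: mean_Vsup_ge0.
have v00 : 0 < v0.
  rewrite ltr_wpDl//.
    by rewrite addr_ge0// !mulr_ge0 ?invr_ge0 ?(ltW b0) ?sqrtr_ge0.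
  by rewrite !mulr_gt0 ?invr_gt0 ?exprn_gt0.
pose lam := Num.sqrt (t / v0); pose D := 2 * Num.sqrt (t * v0).
have lam2 : lam ^+ 2 * v0 = t.
  by rewrite sqr_sqrtr ?divr_ge0 ?(ltW t0) ?(ltW v00)// divfK ?gt_eqF.
have lamD : lam * D = 2 * t.
  rewrite /D mulrCA -sqrtrM ?divr_ge0 ?(ltW t0) ?(ltW v00)//.
  have -> : t / v0 * (t * v0) = t ^+ 2 by field; rewrite gt_eqF.
  by rewrite sqrtr_sqr gtr0_norm.
have lam0 : 0 <= lam by exact: sqrtr_ge0.
pose g (l : R) (x : sample) := l * (Zsup F x - EZ) - l ^+ 2 * Vsup mu F x.
have bg l : bmeas (g l).
  by apply: bmeasB; apply: bmeasZ => //; apply: bmeasB => //; exact: bmeas_cst.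
pose A0 := [set x : sample | v0 <= Vsup mu F x].
pose A l := [set x : sample | t <= g l x].
have mA0 : measurable A0 by exact: bmeas_measurable_ge.
have mA l : measurable (A l) by exact: bmeas_measurable_ge.
have PA l : (P (A l) <= (expR (- t))%:E)%E 
    by apply: chernoff_le (bg l) _; rewrite /g EZE; exact: exp_dev_le1.
have PA0 : (P A0 <= (expR (- t))%:E)%E by exact: Vsup_tail.
apply: (@le_trans _ _ (P ((A lam `|` A (- lam)) `|` A0))).
  apply: le_measure; rewrite ?inE.
  - apply: bmeas_measurable_ge; apply: bmeas_norm; apply: bmeasB => //.
    exact: bmeas_cst.
  - by do 2 apply: measurableU => //.
  move=> x /= hx; have [hv|hv] := leP v0 (Vsup mu F x); [by right|left].
  have hD : D <= `|Zsup F x - EZ| by exact: hx.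
  have lV : lam ^+ 2 * Vsup mu F x <= t.
    by rewrite -lam2 ler_wpM2l ?sqr_ge0// ltW.
  have := ler_wpM2l lam0 hD; rewrite lamD => hl.
  have [hz|hz] := leP 0 (Zsup F x - EZ); [left|right]; rewrite /A /g /=.
    by move: hl; rewrite ger0_norm//; lra.
  by move: hl; rewrite ltr0_norm// sqrrN; lra.
have h3 : (3 * expR (- t))%:E =
    ((expR (- t))%:E + (expR (- t))%:E + (expR (- t))%:E)%E.
  by rewrite -!EFinD; congr EFin; ring.
rewrite h3; apply: le_trans (measureU2 _ _ _) _ => //; first exact: measurableU.
apply: leeD => //; apply: le_trans (measureU2 _ (mA _) (mA _)) _.
by apply: leeD; exact: PA.
Qed.

End empirical_process.

Lemma slack_bound {R : realType} (t : R) : ln 2 <= t ->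
  3 * expR (- t) <= 4 * expR (1 - (Num.sqrt t - Num.sqrt (ln 2)) ^+ 2) + expR (- t).
Proof.
move=> ht; have l2 : 0 < ln 2 :> R by rewrite ln_gt0// ltr1n.
have t0 : 0 < t by exact: lt_le_trans ht.
have s1 : Num.sqrt (ln 2) <= Num.sqrt t by exact: ler_wsqrtr.
have s0 := sqrtr_ge0 (ln 2 : R).
have h : (Num.sqrt t - Num.sqrt (ln 2)) ^+ 2 <= t.
  rewrite -[leRHS]sqr_sqrtr ?(ltW t0)// ler_sqr ?nnegrE; lra.
have : expR (- t) <= expR (1 - (Num.sqrt t - Num.sqrt (ln 2)) ^+ 2).
  by rewrite ler_expR; lra.
by have := expR_ge0 (- t); lra.
Qed.

Theorem corollary2 (R : realType) (d : measure_display) (T : measurableType d)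
    (mu : probability T R) (n : nat) (hn : (1 <= n)%N)
    (b : R) (hb : 0 < b)
    (F : set (T -> R)) (cF : countable F)
    (mF : forall f, F f -> measurable_fun [set: T] f)
    (bF : forall f, F f -> forall w, - b <= f w <= b)
    (t : R) (ht : ln 2 <= t) :
  let P : probability (n.-tuple T) R := power_prob mu n in
  let Z : n.-tuple T -> R := Zsup F in
  let V : n.-tuple T -> R := Vsup mu F in
  let EZ : R := fine ('E_P[Z])%E in
  let EV : R := fine ('E_P[V])%E in
  (P [set x | (2 * Num.sqrt (t * (EV
                + 2 * b / 3 * Num.sqrt (18 * EV * t + 4 * b ^+ 2 * t ^+ 2)
                + 4 * b ^+ 2 * t / 3))
              <= `|Z x - EZ|)%R]
   <= (4 * expR (1 - (Num.sqrt t - Num.sqrt (ln 2)) ^+ 2) + expR (- t))%:E)%E.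
Proof.
(* For the empty class both suprema are 0, as for the class of the zero function. *)
wlog F0 : F cF mF bF / F !=set0.
  move=> H; have [->|/set0P F0] := eqVneq F set0; last exact: H.
  have F1 : [set cst 0 : T -> R] !=set0 by exists (cst 0).
  have ZE : Zsup set0 = Zsup [set cst 0 : T -> R] :> (n.-tuple T -> R).
    apply/funext => x; rewrite /Zsup image_set0 sup0 image_set1 sup1.
    by rewrite big1.
  have VE : Vsup mu set0 = Vsup mu [set cst 0 : T -> R] :> (n.-tuple T -> R).
    apply/funext => x; rewrite /Vsup; congr (fine 'E_(_)[_]%E).
    apply/funext => y; rewrite image_set0 sup0 image_set1 sup1.
    by rewrite big1// => i _; rewrite subrr expr0n.
  rewrite ZE VE; apply: (H _ (countable1 (cst 0 : T -> R)) _ _ F1).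
    by move=> _ ->; exact: measurable_cst.
  by move=> _ -> w; rewrite /= oppr_le0 !ltW.
have t0 : 0 < t by apply: lt_le_trans ht; rewrite ln_gt0// ltr1n.
cbv zeta; apply: (@le_trans _ _ (3 * expR (- t))%:E).
  by apply: Zsup_tail => //; rewrite unlock.
by rewrite lee_fin slack_bound.
Qed.
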